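(* A continuous function $v:\mathbb{T}^d\to\mathbb{R}$ is a viscosity solution of $\bar c+H(x,Dv(x))=0$ on $\mathbb{T}^d$ if and only if $v(x)=T_tv(x)-\bar c\,t$ for all $t\ge0$ and $x\in\mathbb{T}^d$.
   Context: Setting: $1\le m\le d$, $\mathbb{T}^d=\mathbb{R}^d/\mathbb{Z}^d$; $f_1,\dots,f_m$ smooth vector fields satisfying the Hörmander condition; $F(x)=[f_1(x)|\cdots|f_m(x)]$, (F): $F\in C^{1,1}$, rank $F(x)=m$. Admissible pairs: $\gamma$ absolutely continuous, $u\in L^2$, $\dot\gamma=F(\gamma)u$ a.e.; $\Gamma^{\to x}_{0,t}$ those on $[0,t]$ with $\gamma(t)=x$. (L): $L\in C^2(\mathbb{T}^d\times\mathbb{R}^m)$, $D^2_uL\ge0$, $L(x,u)\ge K_1|u|^\sigma-K_2$ ($\sigma>1$). $H(x,p)=\sup_u\{\langle F^*(x)p,u\rangle-L(x,u)\}$. (S): no singular minimizing controls other than zero for $V^T(x)=\inf\{\int_0^TL(\gamma,u):\gamma(0)=x\}$. $\bar c=\lim_{T\to\infty}V^T(x)/T$. Lax–Oleinik semigroup: $T_tv(x)=\inf_{(\gamma,u)\in\Gamma^{\to x}_{0,t}}\{v(\gamma(0))+\int_0^tL(\gamma(s),u(s))\,ds\}$. Assumptions (F), (L), (S) are in force. *)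

(* Defs.v *)
From HB Require Import structures.
From mathcomp Require Import all_boot all_order all_algebra.
From mathcomp Require Import all_classical all_reals all_analysis.
Set Implicit Arguments. Unset Strict Implicit. Unset Printing Implicit Defensive.
Import Order.TTheory GRing.Theory Num.Theory.
Import numFieldNormedType.Exports.
Local Open Scope classical_set_scope.
Local Open Scope ring_scope.

Section Defs.
Context {R : realType}.
Local Notation vec n := 'rV[R]_n.
Local Notation leb := (@lebesgue_measure R).

Definition ebasis {d} (i : 'I_d) : vec d := delta_mx 0 i.

(* functions on the torus T^d = R^d / Z^d, seen as Z^d-periodic functions on R^d *)
Definition Zperiodic {d} {T : Type} (g : vec d -> T) :=
  forall x i, g (x + ebasis i) = g x.

Definition dotv {n} (a b : vec n) : R := \sum_i a 0 i * b 0 i.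
Definition enorm {n} (a : vec n) : R := Num.sqrt (dotv a a).

Fixpoint iterD {d} {W : normedModType R} (s : seq (vec d)) (g : vec d -> W)
  : vec d -> W :=
  match s with [::] => g | v :: s' => 'D_v (iterD s' g) end.
Definition smooth {d} {W : normedModType R} (g : vec d -> W) :=
  forall s x, differentiable (iterD s g) x.

Definition lieb {d} (X Y : vec d -> vec d) : vec d -> vec d :=
  fun x => derive Y x (X x) - derive X x (Y x).

Inductive lie_gen {d m} (f : 'I_m -> vec d -> vec d) : (vec d -> vec d) -> Prop :=
| LieGen i : lie_gen f (f i)
| LieBr X Y : lie_gen f X -> lie_gen f Y -> lie_gen f (lieb X Y).

Definition hormander {d m} (f : 'I_m -> vec d -> vec d) :=
  forall (x w : vec d), exists n (X : 'I_n -> vec d -> vec d) (c : 'I_n -> R),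
    (forall k, lie_gen f (X k)) /\ w = \sum_k c k *: X k x.

Definition Fmat {d m} (f : 'I_m -> vec d -> vec d) (x : vec d) : 'M[R]_(d, m) :=
  \matrix_(i, j) f j x 0 i.
Definition Fu {d m} (f : 'I_m -> vec d -> vec d) (x : vec d) (u : vec m) : vec d :=
  \sum_j u 0 j *: f j x.

Definition condF {d m} (f : 'I_m -> vec d -> vec d) :=
  [/\ forall x, differentiable (Fmat f) x,
      exists K : R, forall x y (w : vec d),
        `| derive (Fmat f) x w - derive (Fmat f) y w | <= K * `|x - y| * `|w|
    & forall x, \rank (Fmat f x) = m].

Definition C2 {V : normedModType R} (g : V -> R) :=
  [/\ forall z, differentiable g z,
      forall v z, differentiable ('D_v g) z
    & forall v w, continuous ('D_w ('D_v g))].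

Definition condL {d m} (L : vec d -> vec m -> R) :=
  [/\ forall u, Zperiodic (fun x => L x u),
      C2 (fun z : vec d * vec m => L z.1 z.2),
      forall x u (w : vec m),
        0 <= derive ('D_((0 : vec d), w) (fun z : vec d * vec m => L z.1 z.2))
               (x, u) ((0 : vec d), w)
    & exists K1 K2 sigma : R, [/\ 0 < K1, 1 < sigma &
        forall x u, K1 * (enorm u) `^ sigma - K2 <= L x u]].

Definition Ham {d m} (f : 'I_m -> vec d -> vec d) (L : vec d -> vec m -> R)
  (x p : vec d) : R :=
  sup [set dotv (p *m Fmat f x) u - L x u | u in [set: vec m]].

Definition AC {d} (g : R -> vec d) (t : R) :=
  forall e : R, 0 < e -> exists dl : R, 0 < dl /\
    forall n (ab : 'I_n -> R * R),
      (forall k, 0 <= (ab k).1 /\ (ab k).1 <= (ab k).2 /\ (ab k).2 <= t) ->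
      (forall k l, k != l -> (ab k).2 <= (ab l).1 \/ (ab l).2 <= (ab k).1) ->
      \sum_k ((ab k).2 - (ab k).1) < dl ->
      \sum_k `| g (ab k).2 - g (ab k).1 | < e.

Definition L2 {m} (u : R -> vec m) (t : R) :=
  (forall j, measurable_fun `[0, t] (fun s => u s 0 j)) /\
  (\int[leb]_(s in `[0%R, t]) ((enorm (u s)) ^+ 2)%:E < +oo)%E.

Definition admissible {d m} (f : 'I_m -> vec d -> vec d) (t : R)
  (gamma : R -> vec d) (u : R -> vec m) :=
  [/\ AC gamma t, L2 u t &
      {ae leb, forall s, s \in `[0, t] ->
         is_derive s 1 gamma (Fu f (gamma s) (u s))}].

Definition cost {d m} (L : vec d -> vec m -> R) (t : R)
  (gamma : R -> vec d) (u : R -> vec m) : \bar R :=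
  \int[leb]_(s in `[0%R, t]) (L (gamma s) (u s))%:E.

Definition LaxOleinik {d m} (f : 'I_m -> vec d -> vec d) (L : vec d -> vec m -> R)
  (t : R) (v : vec d -> R) (x : vec d) : \bar R :=
  ereal_inf [set z | exists gamma u, [/\ admissible f t gamma u, gamma t = x &
               z = ((v (gamma 0))%:E + cost L t gamma u)%E]].

Definition VT {d m} (f : 'I_m -> vec d -> vec d) (L : vec d -> vec m -> R)
  (T : R) (x : vec d) : \bar R :=
  ereal_inf [set z | exists gamma u, [/\ admissible f T gamma u, gamma 0 = x &
               z = cost L T gamma u]].

(* solutions xi of the linearized control system along (gamma,u) with control v,
   xi(0) = 0; xi(T) is the differential of the end-point map at u applied to v *)
Definition lin_sol {d m} (f : 'I_m -> vec d -> vec d) (T : R)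
  (gamma : R -> vec d) (u v : R -> vec m) (xi : R -> vec d) :=
  [/\ AC xi T, xi 0 = 0 &
      {ae leb, forall s, s \in `[0, T] ->
         is_derive s 1 xi (derive (fun y => Fu f y (u s)) (gamma s) (xi s)
                           + Fu f (gamma s) (v s))}].

(* u is singular: the differential of the end-point map at u is not surjective *)
Definition singular {d m} (f : 'I_m -> vec d -> vec d) (T : R)
  (gamma : R -> vec d) (u : R -> vec m) :=
  ~ (forall w : vec d, exists v xi, [/\ L2 v T, lin_sol f T gamma u v xi & xi T = w]).

Definition condS {d m} (f : 'I_m -> vec d -> vec d) (L : vec d -> vec m -> R) :=
  forall T x gamma u, 0 < T -> admissible f T gamma u -> gamma 0 = x ->
    cost L T gamma u = VT f L T x -> singular f T gamma u ->
    {ae leb, forall s, s \in `[0, T] -> u s = 0}.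

Definition C1 {d} (phi : vec d -> R) :=
  (forall x, differentiable phi x) /\ (forall i, continuous ('D_(ebasis i) phi)).
Definition grad {d} (phi : vec d -> R) (x : vec d) : vec d :=
  \row_i derive phi x (ebasis i).

Definition visc_sub {d m} (c : R) (f : 'I_m -> vec d -> vec d)
  (L : vec d -> vec m -> R) (v : vec d -> R) :=
  forall phi x0, C1 phi ->
    (\forall y \near x0, v y - phi y <= v x0 - phi x0) ->
    c + Ham f L x0 (grad phi x0) <= 0.
Definition visc_super {d m} (c : R) (f : 'I_m -> vec d -> vec d)
  (L : vec d -> vec m -> R) (v : vec d -> R) :=
  forall phi x0, C1 phi ->
    (\forall y \near x0, v x0 - phi x0 <= v y - phi y) ->
    0 <= c + Ham f L x0 (grad phi x0).
Definition visc_sol {d m} (c : R) (f : 'I_m -> vec d -> vec d)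
  (L : vec d -> vec m -> R) (v : vec d -> R) :=
  [/\ continuous v, visc_sub c f L v & visc_super c f L v].

End Defs.

(* Main.v *)
Require Import Defs.
From HB Require Import structures.
From mathcomp Require Import all_boot all_order all_algebra.
From mathcomp Require Import all_classical all_reals all_analysis.
From mathcomp Require Import measurable_realfun ring lra.
Import Order.TTheory GRing.Theory Num.Theory.
Import numFieldNormedType.Exports.
Local Open Scope classical_set_scope.
Local Open Scope ring_scope.

(* The Hamiltonian is coercive only along the fields, so everything is done with
   convolutions and explicit horizontal curves.
   If v is a subsolution, its sup-convolution V is Lipschitz and at each x it
   inherits, up to a small error, the viscosity inequality
   <p, F(x)u> <= L(x,u) - c for all u (coercivity of L makes the error uniform in u).
   Hence V(gamma) is absolutely continuous with left Dini derivative at most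
   L(gamma,u) - c, which integrates to v <= T_t v - ct.
   If v is a supersolution, the inf-convolution selects at each x an almost optimal
   bounded control; following it backwards for a short time and iterating (proximal
   aiming) yields admissible curves that almost attain T_t v - ct.
   Conversely, for a fixed point v, constant controls give the subsolution property,
   and near-optimal curves, which remain close to their endpoint for small times by
   coercivity, give the supersolution property. *)

Set Implicit Arguments. Unset Strict Implicit. Unset Printing Implicit Defensive.

(** * Vectors, periodicity and compactness *)

(** [v] is merely continuous: [H] controls gradients only along the fields, so no Euclidean
    Lipschitz bound is at hand, and nothing is known a priori about derivatives of [v] along a
    curve. The penalty of the convolutions is Euclidean, and its gradient [p = 2k(x - y)] is not
    bounded uniformly in [k]. The rescue is that [p] enters only through [F]: replacing [F(y)] by
    [F(x)] costs a multiple of [|p| |x - y|], that is of [k|x - y|^2], which is as small as the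
    oscillation of [v] over the distance [|x - y|]. In the subsolution inequality [F(y)^* p] is
    moreover bounded, since that inequality holds for every control. Both inequalities between [v]
    and [T_t v - ct] tolerate errors proportional to time, so infima are only approached within [e],
    and [e] is shared out over [t] plus a constant; neither minimizers nor measurable selections
    enter. The curves of [T_t v(x)] are prescribed at their final point, which is why flows are
    built backwards from it. *)

Section Vectors.
Context {R : realType}.
Implicit Types (n d m : nat).

Lemma mxnorm_coord n (a : 'rV[R]_n) i : `|a 0 i| <= `|a|.
Proof.
rewrite [leRHS]/Num.norm /= mx_normrE.
by apply/bigmax_geP; right; exists (0, i).
Qed.

Lemma mxnorm_leP n (a : 'rV[R]_n) (e : R) : 0 <= e ->
  (forall i, `|a 0 i| <= e) -> `|a| <= e.
Proof.
move=> e0 H; rewrite [leLHS]/Num.norm /= mx_normrE.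
by apply/bigmax_leP; split => // -[j i] _ /=; rewrite ord1.
Qed.

Lemma dotvC n (a b : 'rV[R]_n) : dotv a b = dotv b a.
Proof. by apply: eq_bigr => i _; rewrite mulrC. Qed.

Lemma dotvDl n (a b c : 'rV[R]_n) : dotv (a + b) c = dotv a c + dotv b c.
Proof. by rewrite -big_split; apply: eq_bigr => i _; rewrite mxE mulrDl. Qed.

Lemma dotvZl n k (a b : 'rV[R]_n) : dotv (k *: a) b = k * dotv a b.
Proof. by rewrite mulr_sumr; apply: eq_bigr => i _; rewrite mxE mulrA. Qed.

Lemma dotvNl n (a b : 'rV[R]_n) : dotv (- a) b = - dotv a b.
Proof. by rewrite -scaleN1r dotvZl mulN1r. Qed.

Lemma dotvBl n (a b c : 'rV[R]_n) : dotv (a - b) c = dotv a c - dotv b c.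
Proof. by rewrite dotvDl dotvNl. Qed.

Lemma dotvDr n (a b c : 'rV[R]_n) : dotv c (a + b) = dotv c a + dotv c b.
Proof. by rewrite !(dotvC c) dotvDl. Qed.

Lemma dotvBr n (a b c : 'rV[R]_n) : dotv c (a - b) = dotv c a - dotv c b.
Proof. by rewrite !(dotvC c) dotvBl. Qed.

Lemma dotvZr n k (a b : 'rV[R]_n) : dotv a (k *: b) = k * dotv a b.
Proof. by rewrite dotvC dotvZl dotvC. Qed.

Lemma dotvNr n (a b : 'rV[R]_n) : dotv a (- b) = - dotv a b.
Proof. by rewrite dotvC dotvNl dotvC. Qed.

Lemma dotv0l n (a : 'rV[R]_n) : dotv 0 a = 0.
Proof. by rewrite -(scale0r 0) dotvZl mul0r. Qed.

Lemma dotv_suml n I (s : seq I) (a : I -> 'rV[R]_n) b :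
  dotv (\sum_(i <- s) a i) b = \sum_(i <- s) dotv (a i) b.
Proof.
elim: s => [|x s IH]; first by rewrite !big_nil dotv0l.
by rewrite !big_cons dotvDl IH.
Qed.

Lemma dotvN n (a : 'rV[R]_n) : dotv (- a) (- a) = dotv a a.
Proof. by rewrite dotvNl dotvNr opprK. Qed.

Lemma dotvDD n (a b : 'rV[R]_n) :
  dotv (a + b) (a + b) = dotv a a + 2 * dotv a b + dotv b b.
Proof. rewrite dotvDl !dotvDr (dotvC b a); ring. Qed.

Lemma ler_normr_dotv n (a b : 'rV[R]_n) : `|dotv a b| <= n%:R * (`|a| * `|b|).
Proof.
apply: (le_trans (ler_norm_sum _ _ _)).
rewrite -[X in X%:R * _](card_ord n) mulr_natl -sumr_const.
by apply: ler_sum => i _; rewrite normrM ler_pM// mxnorm_coord.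
Qed.

Lemma ler_dotv n (a b : 'rV[R]_n) : dotv a b <= n%:R * (`|a| * `|b|).
Proof. exact: le_trans (ler_norm _) (ler_normr_dotv _ _). Qed.

Lemma dotv_ge0 n (a : 'rV[R]_n) : 0 <= dotv a a.
Proof. by apply: sumr_ge0 => i _; rewrite -expr2 sqr_ge0. Qed.

Lemma sqr_mxnorm_le_dotv n (a : 'rV[R]_n) : `|a| ^+ 2 <= dotv a a.
Proof.
rewrite -ler_sqrt ?dotv_ge0// sqrtr_sqr normr_id.
apply: mxnorm_leP; first exact: sqrtr_ge0.
move=> i; rewrite -sqrtr_sqr ler_sqrt ?dotv_ge0//.
rewrite /dotv (bigD1 i)//= -expr2 lerDl.
by apply: sumr_ge0 => j _; rewrite -expr2 sqr_ge0.
Qed.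

Lemma mxnorm_le_enorm n (a : 'rV[R]_n) : `|a| <= enorm a.
Proof.
rewrite /enorm -[leLHS]normr_id -sqrtr_sqr ler_sqrt ?dotv_ge0//.
exact: sqr_mxnorm_le_dotv.
Qed.

Lemma enorm_sqr n (a : 'rV[R]_n) : enorm a ^+ 2 = dotv a a.
Proof. by rewrite sqr_sqrtr// dotv_ge0. Qed.

Lemma dotv_mulmx_Fmat d m (f : 'I_m -> 'rV[R]_d -> 'rV[R]_d) x p u :
  dotv (p *m Fmat f x) u = dotv p (Fu f x u).
Proof.
rewrite [RHS]dotvC /Fu dotv_suml; apply: eq_bigr => j _.
rewrite dotvZl mulrC mxE; congr (_ * _).
by apply: eq_bigr => i _; rewrite !mxE mulrC.
Qed.

Lemma FuN d m (f : 'I_m -> 'rV[R]_d -> 'rV[R]_d) x u : Fu f x (- u) = - Fu f x u.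
Proof. by rewrite /Fu -sumrN; apply: eq_bigr => j _; rewrite mxE scaleNr. Qed.

End Vectors.

Section Periodic.
Context {R : realType} {d : nat}.

Lemma Zperiodic_natmul (T : Type) (g : 'rV[R]_d -> T) (k : nat) x i :
  Zperiodic g -> g (x + k%:R *: ebasis i) = g x.
Proof.
move=> pg; elim: k => [|k IH]; first by rewrite scale0r addr0.
by rewrite -natr1 scalerDl scale1r addrA pg.
Qed.

Lemma Zperiodic_intmul (T : Type) (g : 'rV[R]_d -> T) (k : int) x i :
  Zperiodic g -> g (x + k%:~R *: ebasis i) = g x.
Proof.
move=> pg; case: k => k; first exact: Zperiodic_natmul.
rewrite NegzE -(@Zperiodic_natmul _ g k.+1 (x + _) i)//.
by rewrite -addrA -scalerDl rmorphN/= addNr scale0r addr0.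
Qed.

Lemma Zperiodic_lattice (T : Type) (g : 'rV[R]_d -> T) (k : 'I_d -> int) x
    (s : seq 'I_d) : Zperiodic g ->
  g (x + \sum_(i <- s) (k i)%:~R *: ebasis i) = g x.
Proof.
move=> pg; elim: s x => [|i s IH] x; first by rewrite big_nil addr0.
by rewrite big_cons addrA IH Zperiodic_intmul.
Qed.

(** [k] collects the negated integer parts of the coordinates of [x]. Invariance is claimed at every
    [y], so that a second point can be moved by the same [k], its distance to [x] being
    preserved. *)
Lemma Zperiodic_reduce (x : 'rV[R]_d) : exists k : 'rV[R]_d, `|x + k| <= 1 /\
  forall (T : Type) (g : 'rV[R]_d -> T), Zperiodic g -> forall y, g (y + k) = g y.
Proof.
exists (\sum_i (- Num.floor (x 0 i))%:~R *: ebasis i); split; last first.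
  by move=> T g pg y; exact: (@Zperiodic_lattice T g (fun i => - Num.floor (x 0 i))).
apply: mxnorm_leP => // i.
rewrite mxE summxE (bigD1 i)//= big1 ?addr0; last first.
  by move=> j ji; rewrite !mxE eqxx eq_sym (negbTE ji)/= mulr0.
rewrite !mxE !eqxx/= mulr1 rmorphN/=.
have /andP[h1] := floor_itv (x 0 i); rewrite rmorphD/= => h2.
by rewrite ger0_norm; lra.
Qed.

End Periodic.

(** * Uniform bounds and moduli of continuity on the torus *)

Section Compactness.
Context {R : realType}.

Lemma closed_mxball_compact n (M : R) : compact [set x : 'rV[R]_n | `|x| <= M].
Proof.
apply: bounded_closed_compact.
  exists M; split; first exact: num_real.
  by move=> y My x /= xM; rewrite (le_trans xM)// ltW.
apply: (@closed_comp _ _ (fun x : 'rV[R]_n => `|x|) [set r | r <= M]).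
  by move=> x _; exact: norm_continuous.
exact: closed_le.
Qed.

(** Only [x] is confined to [K]: after a lattice translation bringing [x] into the unit ball, a
    nearby [y] may still lie outside it. *)
Lemma compact_uniformly_continuous (T : pseudoMetricType R) (K : set T)
    (g : T -> R) : compact K -> continuous g -> forall e, 0 < e ->
  exists2 dl, 0 < dl & forall x y, K x -> ball x dl y -> `|g x - g y| < e.
Proof.
move=> cK cg e e0.
pose P dl x := forall y, ball x dl y -> `|g x - g y| < e.
have /compact_near_coveringP/(_ R (0^'+) P _) H := cK.
have : \forall dl \near 0^'+, K `<=` P dl.
  apply: H => x Kx.
  have := cg x; move/cvgrPdist_lt => /(_ (e / 2)); rewrite divr_gt0// => /(_ isT).
  rewrite -filter_from_ballE => -[r /= r0 rg].
  exists (ball x (r / 2), [set i | i < r / 2]) => /=.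
    split; first by apply: nbhsx_ballx; rewrite divr_gt0.
    by apply: nbhs_right_lt; rewrite divr_gt0.
  move=> [x' i] [/= xx' ir] y x'y.
  have h1 : `|g x - g x'| < e / 2.
    by apply: rg; apply: le_ball xx'; rewrite ler_pdivrMr// ler_peMr ?ltW//; lra.
  have h2 : `|g x - g y| < e / 2.
    apply: rg; rewrite [r]splitr; apply: ball_triangle xx' _.
    by apply: le_ball x'y; rewrite ltW.
  rewrite [e]splitr -[g x' - g y](subrKA (g x)) (le_lt_trans (ler_normD _ _))//.
  by rewrite ltrD// distrC.
move=> near0; near (0 : R)^'+ => dl.
exists dl => //.
by move=> x y Kx xy; apply: (near near0 dl _ x Kx) => //.
Unshelve. all: by end_near. Qed.

Context {d m : nat}.
Variable G : 'rV[R]_d -> 'rV[R]_m -> R.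
Hypothesis Gcont : continuous (fun z : 'rV[R]_d * 'rV[R]_m => G z.1 z.2).
Hypothesis Gper : forall u, Zperiodic (fun x => G x u).

Lemma periodic_param_bounded (r : R) :
  exists2 B, 0 < B & forall x u, `|u| <= r -> `|G x u| <= B.
Proof.
pose K := [set x : 'rV[R]_d | `|x| <= 1] `*` [set u : 'rV[R]_m | `|u| <= r].
have cK : compact K by apply: compact_setX; exact: closed_mxball_compact.
have [r0|r0] := leP 0 r; last first.
  exists 1 => // x u ur; have := normr_ge0 u; lra.
have K0 : K !=set0 by exists (0, 0); split => /=; rewrite normr0.
have cf : {within K, continuous (fun z => `|G z.1 z.2|)}.
  apply: continuous_subspaceT => z.
  apply: (@continuous_comp _ _ _ (fun z => G z.1 z.2) Num.norm).
    exact: Gcont.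
  exact: norm_continuous.
have [c cK0 Hc] := compact_EVT_max K0 cK cf.
exists (`|G c.1 c.2| + 1); first by rewrite ltr_wpDl.
move=> x u ur; have [k [xk Hk]] := Zperiodic_reduce x.
rewrite -(Hk _ _ (Gper u)).
apply: le_trans (Hc (x + k, u) _) _; last by rewrite lerDl.
by rewrite inE; split.
Qed.

Lemma periodic_param_uniform (r e : R) : 0 < e -> exists2 dl, 0 < dl &
  forall x y u, `|u| <= r -> `|x - y| <= dl -> `|G x u - G y u| <= e.
Proof.
move=> e0.
pose K := [set x : 'rV[R]_d | `|x| <= 1] `*` [set u : 'rV[R]_m | `|u| <= r].
have cK : compact K by apply: compact_setX; exact: closed_mxball_compact.
have [dl dl0 H] := compact_uniformly_continuous cK Gcont e0.
exists (dl / 2); first by rewrite divr_gt0.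
move=> x y u ur xy; have [k [xk Hk]] := Zperiodic_reduce x.
rewrite -(Hk _ _ (Gper u)) -(Hk _ _ (Gper u) y).
apply/ltW/(H (x + k, u) (y + k, u)); first by split.
split => /=; last exact: ballxx.
rewrite -ball_normE /= opprD addrACA subrr addr0 (le_lt_trans xy)//; lra.
Qed.

End Compactness.

Section CompactnessScalar.
Context {R : realType} {d : nat}.
Variable g : 'rV[R]_d -> R.
Hypotheses (gcont : continuous g) (gper : Zperiodic g).

(** A function of [x] alone is treated as one with a control in the zero-dimensional space, so that
    the parametrized results apply at the control 0. *)
Let gcont2 : continuous (fun z : 'rV[R]_d * 'rV[R]_0 => g z.1).
Proof. by move=> z; apply: continuous_comp; [exact: cvg_fst|exact: gcont]. Qed.

Lemma periodic_bounded : exists2 B, 0 < B & forall x, `|g x| <= B.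
Proof.
have [B B0 H] := @periodic_param_bounded _ _ _ (fun x _ => g x) gcont2
  (fun=> gper) 0.
by exists B => // x; apply: (H x 0); rewrite normr0.
Qed.

Lemma periodic_uniform e : 0 < e -> exists2 dl, 0 < dl &
  forall x y, `|x - y| <= dl -> `|g x - g y| <= e.
Proof.
move=> e0; have [dl dl0 H] := @periodic_param_uniform _ _ _ (fun x _ => g x)
  gcont2 (fun=> gper) 0 e e0.
by exists dl => // x y xy; apply: (H x y 0); rewrite ?normr0.
Qed.

End CompactnessScalar.

(** * Chain rule and Lipschitz fields *)

Section ChainRule.
Context {R : realType}.

Lemma is_derive_comp_diff (V W : normedModType R) (f : V -> W) (g : R -> V)
    (s : R) (dg : V) :
  is_derive s 1 g dg -> differentiable f (g s) ->
  is_derive s 1 (f \o g) ('d f (g s) dg).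
Proof.
move=> [dg1 dgE] df.
have dgs : differentiable g s by apply/derivable1_diffP.
have dfg : differentiable (f \o g) s by exact: differentiable_comp.
apply: DeriveDef; first exact/derivable1_diffP.
by rewrite deriveE// diff_comp//= -dgE deriveE.
Qed.

Lemma is_derive_coord n (g : R -> 'rV[R]_n) (s : R) (dg : 'rV[R]_n) i :
  is_derive s 1 g dg -> is_derive s 1 (fun r => g r 0 i) (dg 0 i).
Proof.
move=> [dg1 dgE]; apply: DeriveDef; first by move/derivable_mxP : dg1; apply.
by move: dgE; rewrite derive_mx// => /(congr1 (fun M : 'rV_n => M 0 i)); rewrite mxE.
Qed.

Lemma is_derive_row n (g : R -> 'rV[R]_n) (s : R) (dg : 'rV[R]_n) :
  (forall i, is_derive s 1 (fun r => g r 0 i) (dg 0 i)) -> is_derive s 1 g dg.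
Proof.
move=> H.
have D : derivable g s 1.
  by apply/derivable_mxP => i j; rewrite ord1; case: (H j).
apply: DeriveDef => //; rewrite derive_mx//; apply/rowP => i; rewrite mxE.
by case: (H i).
Qed.

Lemma is_derive_line n (y w : 'rV[R]_n) (s : R) :
  is_derive s 1 (fun r : R => y + r *: w) w.
Proof.
apply: is_derive_row => i.
rewrite (_ : (fun r => _) = cst (y 0 i) + (w 0 i) \*: id); last first.
  by apply/funext => r; rewrite !mxE mulrC.
by apply: is_derive_eq; rewrite add0r [_ *: _]mulr1.
Qed.

End ChainRule.

Section LipschitzFields.
Context {R : realType} {d m : nat}.
Variable f : 'I_m -> 'rV[R]_d -> 'rV[R]_d.
Hypotheses (fsmooth : forall i, smooth (f i)) (fper : forall i, Zperiodic (f i)).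

Lemma periodic_vec_bounded (W : normedModType R) (g : 'rV[R]_d -> W) :
  continuous g -> Zperiodic g -> exists2 B, 0 < B & forall x, `|g x| <= B.
Proof.
move=> gc gp; have [|x i|B B0 H] := @periodic_bounded R d (fun x => `|g x|).
- by move=> x; apply: continuous_comp; [exact: gc|exact: norm_continuous].
- by rewrite gp.
- by exists B => // x; rewrite -[leLHS]normr_id.
Qed.

Lemma Zperiodic_derive (W : normedModType R) (g : 'rV[R]_d -> W) w :
  Zperiodic g -> Zperiodic ('D_w g).
Proof.
move=> gp x i; rewrite /derive.
suff -> : (fun h : R => h^-1 *: ((g \o shift (x + ebasis i)) (h *: w) -
    g (x + ebasis i))) = (fun h => h^-1 *: ((g \o shift x) (h *: w) - g x)) by [].
by apply/funext => h /=; rewrite addrA !gp.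
Qed.

Lemma Fu_bounded : exists2 M, 0 < M & forall x u, `|Fu f x u| <= M * `|u|.
Proof.
have /choice[B HB] j : exists B, 0 < B /\ forall x, `|f j x| <= B.
  have [|B B0 H] := periodic_vec_bounded _ (fper j); last by exists B.
  by move=> x; apply: differentiable_continuous; exact: (fsmooth j [::]).
exists (1 + \sum_j B j) => [|x u].
  by rewrite ltr_wpDr// sumr_ge0// => j _; rewrite ltW//; case: (HB j).
rewrite mulrDl mul1r ler_wpDl// (le_trans (ler_norm_sum _ _ _))// mulr_suml.
apply: ler_sum => j _; rewrite normrZ mulrC ler_pM// ?mxnorm_coord//.
by case: (HB j).
Qed.

(** Periodicity bounds the first partial derivatives. The mean value theorem is an equality only for
    scalar functions, so it is applied to each coordinate along the segment, which suffices for the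
    sup norm. *)
Lemma field_lipschitz j : exists2 K, 0 < K & forall x y, `|f j x - f j y| <= K * `|x - y|.
Proof.
have df x : differentiable (f j) x by exact: (fsmooth j [::]).
have /choice[B HB] k : exists B, 0 < B /\ forall x, `|'D_(ebasis k) (f j) x| <= B.
  have [||B B0 H] := @periodic_vec_bounded _ ('D_(ebasis k) (f j)); last by exists B.
    by move=> x; apply: differentiable_continuous; exact: (fsmooth j [:: _]).
  exact: Zperiodic_derive.
have S0 : 0 <= \sum_k B k by rewrite sumr_ge0// => k _; rewrite ltW//; case: (HB k).
exists (1 + \sum_k B k) => [|x y]; first by rewrite ltr_wpDr.
rewrite mulrDl mul1r ler_wpDl//.
have Db z w : `|'d (f j) z w| <= (\sum_k B k) * `|w|.
  rewrite [w in leLHS]row_sum_delta linear_sum (le_trans (ler_norm_sum _ _ _))//.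
  rewrite mulr_suml; apply: ler_sum => k _; rewrite linearZ normrZ mulrC.
  rewrite ler_pM// ?mxnorm_coord// -deriveE//.
  by case: (HB k).
apply: mxnorm_leP => [|i]; first by rewrite mulr_ge0.
pose g (s : R) : 'rV[R]_d := y + s *: (x - y).
have dg (s : R) : is_derive s 1 g (x - y).
  exact: is_derive_line.
have dfg (s : R) : is_derive s 1 (fun s : R => f j (g s) 0 i) ('d (f j) (g s) (x - y) 0 i).
  apply: (@is_derive_coord _ d (f j \o g)).
  exact: is_derive_comp_diff.
have [|c _] := @MVT R _ _ 0 1 ltr01 (fun s _ => dfg s).
  apply: continuous_subspaceT => s; apply: differentiable_continuous.
  by apply/derivable1_diffP; case: (dfg s).
rewrite /g scale0r scale1r addr0 subrKC subr0 mulr1 !mxE => ->.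
exact: le_trans (mxnorm_coord _ _) (Db _ _).
Qed.

Lemma Fu_lipschitz : exists2 K, 0 < K &
  forall x y u, `|Fu f x u - Fu f y u| <= K * (`|x - y| * `|u|).
Proof.
have /choice[B HB] j : exists B, 0 < B /\ forall x y, `|f j x - f j y| <= B * `|x - y|.
  by have [B B0 H] := field_lipschitz j; exists B.
exists (1 + \sum_j B j) => [|x y u].
  by rewrite ltr_wpDr// sumr_ge0// => j _; rewrite ltW//; case: (HB j).
rewrite mulrDl mul1r ler_wpDl ?mulr_ge0// /Fu -sumrB.
rewrite (le_trans (ler_norm_sum _ _ _))// mulr_suml.
apply: ler_sum => j _; rewrite -scalerBr normrZ mulrCA mulrC mulrA.
rewrite ler_pM ?mulr_ge0// ?mxnorm_coord//.
  by rewrite mulrC; case: (HB j).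
Qed.

End LipschitzFields.

(** * Absolutely continuous functions *)

Section Measurability.
Context {R : realType}.

(** An open set is a countable union of boxes with rational centre and radius, and the preimage of a
    box is a finite intersection of conditions on single coordinates. *)
Lemma measurable_fun_continuous_coord n (G : 'rV[R]_n -> R) (w : R -> 'rV[R]_n)
    (D : set R) : measurable D -> continuous G ->
  (forall j, measurable_fun D (fun s => w s 0 j)) ->
  measurable_fun D (fun s => G (w s)).
Proof.
move=> mD cG mw; apply: (measurability _ (RGenOInfty.measurableE R)).
move=> _ [_ [a ->] <-].
pose O : set 'rV[R]_n := G @^-1` `]a, +oo[.
have oO : open O.
  by apply: open_comp; [move=> x _; exact: cG|rewrite set_itvoy; exact: open_gt].
pose box (q : 'rV[rat]_n * rat) : set 'rV[R]_n :=
  [set z | forall i, `|z 0 i - ratr (q.1 0 i)| < ratr q.2].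
have mbox q : measurable (D `&` w @^-1` (box q)).
  rewrite [X in measurable X](_ : _ = D `&` \bigcap_(i in [set: 'I_n])
      (D `&` (fun s => `|w s 0 i - ratr (q.1 0 i)|) @^-1` `]-oo, (ratr q.2)[)).
    apply: measurableI => //; apply: fin_bigcap_measurable => //.
    move=> i _.
    have mf : measurable_fun D (fun s => `|w s 0 i - ratr (q.1 0 i)|).
      by apply: measurableT_comp => //; exact: measurable_funB.
    by apply: mf => //; exact: measurable_itv.
  apply/seteqP; split => s /=.
    by move=> [Ds H]; split => // i _; split => //=; rewrite in_itv/=; exact: H.
  by move=> [Ds H]; split => // i; have [_ /=] := H i I; rewrite in_itv.
(* Enumerates the rational boxes through their codes; a box that is not contained in [O], or an
   invalid code, contributes the empty set. *)
pose F (k : nat) : set R := match unpickle k with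
  | Some q => if `[< box q `<=` O >] then D `&` w @^-1` (box q) else set0
  | None => set0 end.
rewrite [X in measurable X](_ : _ = \bigcup_k F k).
  apply: bigcupT_measurable => k; rewrite /F; case: unpickle => [q|] //.
  by case: ifPn.
apply/seteqP; split => s /=; last first.
  move=> [k _]; rewrite /F; case: unpickle => [q|] //.
  by case: ifPn => // /asboolP qO [Ds ws]; split => //; exact: qO.
move=> [Ds Os].
have : nbhs (w s) O by apply: open_nbhs_nbhs; split.
rewrite -nbhs_ballE => -[e /= e0 eO].
have [|r] := @rat_in_itvoo R 0 (e / 2); first by rewrite divr_gt0.
rewrite in_itv/= => /andP[r0 re].
have /choice[c Hc] i : exists c : rat, `|w s 0 i - ratr c| < ratr r :> R.
  have [|c] := @rat_in_itvoo R (w s 0 i - ratr r) (w s 0 i + ratr r); first lra.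
  rewrite in_itv/= => /andP[c1 c2]; exists c; rewrite ltr_norml; lra.
exists (pickle ((\row_i c i, r) : 'rV[rat]_n * rat)) => //.
rewrite /F pickleK asboolT.
  by split => //= i; rewrite mxE.
move=> z zb; apply: eO; rewrite -ball_normE/=.
apply: (@le_lt_trans _ _ (ratr r + ratr r)); last lra.
apply: mxnorm_leP => [|i]; first by lra.
rewrite !mxE; have := zb i; rewrite mxE distrC => /ltW h1.
rewrite -(subrKA (ratr (c i))) (le_trans (ler_normD _ _))// lerD//.
by rewrite ltW.
Qed.

Lemma measurable_fun_continuous_coord2 d m (L : 'rV[R]_d -> 'rV[R]_m -> R)
    (g : R -> 'rV[R]_d) (u : R -> 'rV[R]_m) (D : set R) : measurable D ->
  continuous (fun z : 'rV[R]_d * 'rV[R]_m => L z.1 z.2) ->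
  (forall j, measurable_fun D (fun s => g s 0 j)) ->
  (forall j, measurable_fun D (fun s => u s 0 j)) ->
  measurable_fun D (fun s => L (g s) (u s)).
Proof.
move=> mD cL mg mu.
pose G (z : 'rV[R]_(d + m)) := L (lsubmx z) (rsubmx z).
have cG : continuous G.
  move=> z; apply: (@continuous_comp _ _ _
    (fun z : 'rV[R]_(d + m) => (lsubmx z, rsubmx z)) (fun z => L z.1 z.2)).
    apply: differentiable_continuous; apply: differentiable_pair.
      exact: differentiable_lsubmx.
    exact: differentiable_rsubmx.
  exact: cL.
have := @measurable_fun_continuous_coord _ G (fun s => row_mx (g s) (u s)) _ mD cG.
rewrite /G; under eq_fun do rewrite row_mxKl row_mxKr.
apply => j; case: (split_ordP j) => k ->.
  by under eq_fun do rewrite row_mxEl; exact: mg.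
by under eq_fun do rewrite row_mxEr; exact: mu.
Qed.

End Measurability.

Section AbsolutelyContinuous.
Context {R : realType}.
Local Notation leb := (@lebesgue_measure R).

Definition ACr (g : R -> R) (t : R) :=
  forall e : R, 0 < e -> exists dl : R, 0 < dl /\
    forall n (ab : 'I_n -> R * R),
      (forall k, 0 <= (ab k).1 /\ (ab k).1 <= (ab k).2 /\ (ab k).2 <= t) ->
      (forall k l, k != l -> (ab k).2 <= (ab l).1 \/ (ab l).2 <= (ab k).1) ->
      \sum_k ((ab k).2 - (ab k).1) < dl ->
      \sum_k `| g (ab k).2 - g (ab k).1 | < e.

(** The upper left Dini derivative of [g] at [s] is at most [c]. The left side is the useful one: a
    smooth function touching [g] from below at [s] bounds [g s - g r] from above, and this is an
    upper bound of the difference quotient exactly when [r < s]. *)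
Definition left_dini_le (g : R -> R) (s c : R) :=
  forall e, 0 < e -> exists2 dl, 0 < dl &
    forall r, s - dl < r -> r < s -> g s - g r <= (c + e) * (s - r).

Lemma sum_itv_le_measure n (ab : 'I_n -> R * R) (U : set R) :
  measurable U -> (forall k, (ab k).1 <= (ab k).2) ->
  (forall k, `](ab k).1, (ab k).2] `<=` U) ->
  (forall k l, k != l -> (ab k).2 <= (ab l).1 \/ (ab l).2 <= (ab k).1) ->
  ((\sum_k ((ab k).2 - (ab k).1))%:E <= leb U)%E.
Proof.
move=> mU ab1 abU abd.
pose F k := `](ab k).1, (ab k).2]%classic.
have mF k : measurable (F k) by exact: measurable_itv.
have tF : trivIset setT F.
  apply/trivIsetP => k l _ _ kl; apply/seteqP; split => // s [].
  by rewrite /F /= !in_itv/= => /andP[k1 k2] /andP[l1 l2]; case: (abd _ _ kl); lra.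
have mbF : measurable (\big[setU/set0]_k F k) by exact: bigsetU_measurable.
have := measure_semi_additive_ord leb mF tF mbF.
rewrite -sumEFin => E; rewrite (_ : (\sum_k _)%E = leb (\big[setU/set0]_k F k)).
  apply: le_measure; rewrite ?inE//.
  apply: (big_ind (fun A => A `<=` U)) => // [A B AU BU x [/AU|/BU]//|k _].
  exact: abU.
rewrite E; apply: eq_bigr => k _; transitivity (leb `](ab k).1, (ab k).2]); last by [].
rewrite lebesgue_measure_itv/= lte_fin.
case: ltP => // h; have -> : (ab k).1 = (ab k).2 by apply/eqP; rewrite eq_le ab1 h.
by rewrite subrr.
Qed.

(** The infimum of the points of [[a, b]] satisfying [P] satisfies [P] by the last hypothesis, and
    by the one before it cannot exceed [a]. The induction descends because Dini bounds look to the
    left. *)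
Lemma real_induction_down (P : R -> Prop) (a b : R) : a <= b -> P b ->
  (forall s, a < s -> s <= b -> P s ->
     exists2 dl, 0 < dl & forall r, s - dl < r -> r < s -> a <= r -> P r) ->
  (forall s, a <= s -> s < b ->
     (forall dl, 0 < dl -> exists r, [/\ s < r, r < s + dl, r <= b & P r]) -> P s) ->
  P a.
Proof.
move=> ab Pb Pl Pr.
pose A := [set s | [/\ a <= s, s <= b & P s]].
have Ab : A b by split.
have iA : has_inf A by split; [exists b|exists a => s []].
have la : a <= inf A by apply: lb_le_inf; [exists b|move=> s []].
have lb' : inf A <= b by apply: ge_inf => //; case: iA.
have PA : P (inf A).
  have [E|neq] := eqVneq (inf A) b; first by rewrite E.
  have lt_b : inf A < b by rewrite lt_neqAle neq.
  have [//|nP] := pselect (P (inf A)).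
  apply: Pr => // dl dl0.
  have [r [ar rb Pr'] rdl] := inf_adherent dl0 iA.
  exists r; split => //.
  rewrite lt_neqAle; apply/andP; split.
    by apply: contra_notN nP => /eqP ->.
  by apply: ge_inf => //; case: iA.
have [<-//|neq] := eqVneq (inf A) a.
have lta : a < inf A by rewrite lt_neqAle eq_sym neq.
have [dl dl0 H] := Pl _ lta lb' PA.
pose r := Num.max a (inf A - dl / 2).
have r1 : r < inf A by rewrite gt_max lta/=; lra.
have r2 : a <= r by rewrite le_max lexx.
have r3 : inf A - dl < r by rewrite lt_max; apply/orP; right; lra.
have : inf A <= r.
  apply: ge_inf; first by case: iA.
  split => //; last exact: H.
  by apply: le_trans (ltW r1) _.
by rewrite leNgt r1.
Qed.

(** Only upper semicontinuity from the right is asked for, so that [Phi] may contain monotone terms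
    that are not known to be continuous. *)
Lemma left_nonincreasing (Phi : R -> R) (a b : R) : a <= b ->
  (forall s, a < s -> s <= b ->
     exists2 dl, 0 < dl & forall r, s - dl < r -> r < s -> a <= r -> Phi s <= Phi r) ->
  (forall s, a <= s -> s < b -> forall e, 0 < e ->
     exists2 dl, 0 < dl & forall r, s < r -> r < s + dl -> r <= b -> Phi r <= Phi s + e) ->
  Phi b <= Phi a.
Proof.
move=> ab Hl Hr; apply: (@real_induction_down (fun s => Phi b <= Phi s) _ _ ab) => //.
  move=> s as_ sb bs; have [dl dl0 H] := Hl s as_ sb.
  by exists dl => // r r1 r2 r3; exact: le_trans bs (H r r1 r2 r3).
move=> s as_ sb H; apply/ler_addgt0Pr => e e0.
have [dl dl0 Hdl] := Hr s as_ sb e e0.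
have [r [sr rdl rb Pr]] := H dl dl0.
exact: le_trans Pr (Hdl r sr rdl rb).
Qed.

End AbsolutelyContinuous.

(** * Integration of an almost everywhere Dini bound *)

Section ACIntegral.
Context {R : realType}.
Local Notation leb := (@lebesgue_measure R).

Lemma ACr_uniform (G : R -> R) t : ACr G t -> forall e, 0 < e ->
  exists2 dl, 0 < dl & forall r s, 0 <= r -> r <= s -> s <= t -> s - r < dl ->
    `|G s - G r| < e.
Proof.
move=> aG e e0; have [dl [dl0 H]] := aG e e0; exists dl => // r s r0 rs st srdl.
have := H 1%N (fun=> (r, s)); rewrite !big_ord1; apply => //.
by move=> k l; rewrite !ord1.
Qed.

Lemma ACr_continuous (G : R -> R) t : ACr G t -> {within `[0, t], continuous G}.
Proof.
move=> aG; apply/subspace_continuousP => s /=; rewrite in_itv/= => /andP[s0 st].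
apply/cvgrPdist_lt => e e0; have [dl dl0 H] := ACr_uniform aG e0.
near=> r; have : r \in `[0, t] by near: r; apply: withinT.
rewrite in_itv/= => /andP[r0 rt].
have rs : `|s - r| < dl by near: r; apply: cvg_within; exact: nbhsx_ballx.
have [sr|rs'] := leP s r.
  by rewrite distrC; apply: H => //; rewrite ltr_norml in rs; lra.
by apply: H => //; rewrite ?ltW// ltr_norml in rs *; lra.
Unshelve. all: by end_near. Qed.

Lemma is_derive_left_quotient (g : R -> R) (s c e : R) : is_derive s 1 g c -> 0 < e ->
  exists2 dl, 0 < dl & forall r, s - dl < r -> r < s ->
    (c - e) * (s - r) <= g s - g r <= (c + e) * (s - r).
Proof.
move=> [dg gE] e0.
have : h^-1 *: (g (h *: 1 + s) - g s) @[h --> 0^'] --> c.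
  by move: dg; rewrite /derivable -gE => /cvg_ex[l dg]; rewrite /derive (cvg_lim _ dg).
move=> /cvgrPdist_le /(_ e e0); rewrite near_withinE -nbhs_ballE => -[dl /= dl0 H].
exists dl => // r rs1 rs2.
have rs0 : r - s != 0 by rewrite subr_eq0 lt_eqF.
have := H (r - s) _ rs0; rewrite /ball/= sub0r normrN ltr0_norm; last lra.
rewrite /GRing.scale/= mulr1 subrK => /(_ ltac:(lra)).
rewrite ler_norml.
have -> : (r - s)^-1 * (g r - g s) = (g s - g r) / (s - r) by field; lra.
set q := _ / (s - r); have -> : g s - g r = q * (s - r) by rewrite /q divfK//; lra.
by move=> /andP[h1 h2]; rewrite !ler_pM2r; lra.
Qed.

Lemma is_derive_left_dini_le (g : R -> R) (s c : R) :
  is_derive s 1 g c -> left_dini_le g s c.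
Proof.
move=> gs e e0; have [dl dl0 H] := is_derive_left_quotient gs e0.
by exists dl => // r r1 r2; have /andP[] := H r r1 r2.
Qed.

(* Inside an open set of small measure containing the exceptional points, the
   increments are paid for by the variation [V]; elsewhere by the Dini bound. *)
Lemma ACr_le_integral (G h : R -> R) (t a b : R) : ACr G t ->
  leb.-integrable `[0, t] (EFin \o h) ->
  {ae leb, forall s, s \in `]0, t[ -> left_dini_le G s (h s)} ->
  0 <= a -> a <= b -> b <= t ->
  G b - G a <= \int[leb]_(s in `[a, b]) h s.
Proof.
move=> aG ih aeG a0 ab bt.
have [->|ab'] := eqVneq a b.
  by rewrite subrr set_itv1 Rintegral_set1.
have {ab'} ltab : a < b by rewrite lt_neqAle ab'.
have mI : measurable `[0, t]%classic by exact: measurable_itv.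
pose h0 := h \_ `[0, t].
have ih0 : leb.-integrable setT (EFin \o h0).
  by rewrite -restrict_EFin; apply/integrable_restrict => //=; rewrite setTI.
have ih0S D : measurable D -> leb.-integrable D (EFin \o h0).
  by move=> mD; apply: integrableS ih0.
pose I s := \int[leb]_(r in `[0, s]) h0 r.
have IE : \int[leb]_(s in `[a, b]) h s = I b - I a.
  rewrite /I Rintegral_itvB; last 3 first.
    exact: ih0S.
    by rewrite bnd_simp.
    by rewrite bnd_simp.
  rewrite Rintegral_itv_obnd_cbnd; last exact: ih0S.
  apply: eq_Rintegral => s; rewrite inE/= in_itv/= => /andP[s1 s2].
  by rewrite /h0 patchE mem_set//= in_itv/=; apply/andP; split; lra.
rewrite IE.
have Iae : {ae leb, forall s, s \in `]0, t[ -> is_derive s 1 I (h s)}.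
  have loc : locally_integrable [set: R] h0 by exact: open_integrable_locally openT ih0.
  have := @FTC1 R h0 (BLeft 0) (fun y => ih0S _ (measurable_itv _)) loc.
  apply: filterS; first exact: (ae_filter_ringOfSetsType leb).
  move=> s H; rewrite in_itv/= => /andP[s0 st].
  have [|D DE] := H; first by [].
  apply: DeriveDef => //; rewrite -derive1E DE /h0 patchE mem_set//= in_itv/=.
  by rewrite !ltW.
have Icont : {within `[0, t], continuous I}.
  by apply: parameterized_integral_continuous; [lra|exact: ih0S].
apply/ler_addgt0Pl => e e0.
(* The error [e] has three equal shares: the variation of [G] over the small open set, the integral
   of [|h|] over it, and the linear slack [e1 * (b - a)]. *)
pose e1 := e / (3 * (1 + b - a)).
have e10 : 0 < e1 by rewrite divr_gt0//; lra.
have e3 : 0 < e / 3 by lra.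
have [dV [dV0 HV]] := aG _ e3.
have [dI [dI0 HI]] := integral_normr_continuous ih0 e3.
pose dm := Num.min dV dI.
have dm0 : 0 < dm by rewrite lt_min dV0.
(* The end point [t] is declared exceptional because the Dini bound is given on the open interval
   only. The point 0 never occurs, as the points examined below satisfy [s > a >= 0]. *)
have [N [mN N0 NP]] : leb.-negligible (~` [set s | s \in `]0, t[ ->
    left_dini_le G s (h s) /\ is_derive s 1 I (h s)] `|` [set t]).
  apply: negligibleU; last by apply/negligibleP => //; exact: lebesgue_measure_set1.
  have : {ae leb, forall s, s \in `]0, t[ ->
    left_dini_le G s (h s) /\ is_derive s 1 I (h s)}.
    move: aeG Iae; apply: filterS2; first exact: (ae_filter_ringOfSetsType leb).
    by move=> s H1 H2 st; split; [exact: H1|exact: H2].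
  by [].
have [U [oU NU Udm]] : exists U : set R, [/\ open U, N `<=` U & (leb U < dm%:E)%E].
  have [|U [oU NU Udm]] := @lebesgue_regularity_outer R N dm mN _ dm0.
    by rewrite [X in (X < _)%E]N0.
  exists U; split => //; have mU := open_measurable oU.
  rewrite -(setDUK NU) (le_lt_trans (measureU2 _ _ _))//.
    exact: measurableD.
  by rewrite [X in (X + _)%E]N0 add0e.
have mU : measurable U by exact: open_measurable.
(* [V s] will be the total variation of [G] over disjoint intervals inside [U] to the right of [s].
   Absolute continuity keeps it below [e / 3], and over an interval inside [U] it falls at least as
   much as [G] can rise. *)
pose fam (s : R) n (ab : 'I_n -> R * R) :=
  [/\ forall k, s <= (ab k).1 /\ (ab k).1 <= (ab k).2 /\ (ab k).2 <= t,
      forall k l, k != l -> (ab k).2 <= (ab l).1 \/ (ab l).2 <= (ab k).1 &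
      forall k, `](ab k).1, (ab k).2] `<=` U].
pose W s : set R := [set x | exists n (ab : 'I_n -> R * R),
  fam s n ab /\ x = \sum_k `|G (ab k).2 - G (ab k).1|].
have Wub s : 0 <= s -> ubound (W s) (e / 3).
  move=> s0 _ [n [c [[c1 c2 c3] ->]]]; apply/ltW/HV => //.
    by move=> k; have [sk ?] := c1 k; split => //; exact: le_trans sk.
  rewrite -lte_fin; apply: (@le_lt_trans _ _ (leb U)).
    by apply: sum_itv_le_measure => // k; have [_ []] := c1 k.
  by rewrite (lt_le_trans Udm)// lee_fin ge_min lexx.
have W0 s : W s 0.
  exists 0%N, (fun=> (0, 0)); split; last by rewrite big_ord0.
  by split => [[]|[]|[]].
have hsW s : 0 <= s -> has_sup (W s).
  by move=> s0; split; [exists 0; exact: W0|exists (e / 3); exact: Wub].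
pose V s := sup (W s).
have Vle s : 0 <= s -> V s <= e / 3.
  by move=> s0; apply: ge_sup; [exists 0; exact: W0|exact: Wub].
have V0 s : 0 <= s -> 0 <= V s.
  by move=> s0; apply: ub_le_sup; [case: (hsW s s0)|exact: W0].
have Vmono r s : 0 <= r -> r <= s -> V s <= V r.
  move=> r0 rs; apply: ge_sup; first by exists 0; exact: W0.
  move=> _ [n [c [[c1 c2 c3] ->]]]; apply: ub_le_sup; first by case: (hsW r r0).
  exists n, c; split => //; split => // k; have [sk ?] := c1 k.
  by split => //; exact: le_trans sk.
have VU r s : 0 <= r -> r <= s -> s <= t -> `]r, s] `<=` U ->
    V s + `|G s - G r| <= V r.
  move=> r0 rs st rsU; rewrite -lerBrDr; apply: ge_sup; first by exists 0; exact: W0.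
  move=> _ [n [c [[c1 c2 c3] ->]]]; rewrite lerBrDr; apply: ub_le_sup.
    by case: (hsW r r0).
  exists n.+1, (fun k => if unlift ord0 k is Some k' then c k' else (r, s)).
  split; last first.
    rewrite big_ord_recl unlift_none addrC; congr (_ + _).
    by apply: eq_bigr => k _; rewrite liftK.
  split=> [k|k l|k]; case: (unliftP ord0 k) => [k' Ek|Ek].
  - by have [sk ?] := c1 k'; split => //; exact: le_trans sk.
  - by [].
  - case: (unliftP ord0 l) => [l' El|El] kl.
      by apply: c2; apply: contra_neq kl; rewrite Ek El => ->.
    by right; have [? ?] := c1 k'.
  - case: (unliftP ord0 l) => [l' El|El] kl; last by rewrite Ek El eqxx in kl.
    by left; have [? ?] := c1 l'.
  - exact: c3.
  - exact: rsU.
(* The counterpart of [V] for the integral [I]: over an interval inside [U], [J] grows at least as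
   much as [I] can fall. *)
pose J s := \int[leb]_(r in `[0, s] `&` U) `|h0 r|.
have inh0 D : measurable D -> leb.-integrable D (EFin \o (fun r => `|h0 r|)).
  by move=> mD; have := integrable_abse (ih0S D mD).
have mIU s : measurable (`[0, s] `&` U) by apply: measurableI => //; exact: measurable_itv.
have Jmono r s : r <= s -> J r <= J s.
  move=> rs; rewrite /J /Rintegral fine_le//.
  - by apply: integrable_fin_num; [exact: mIU|exact: (inh0 _ (mIU _))].
  - by apply: integrable_fin_num; [exact: mIU|exact: (inh0 _ (mIU _))].
  apply: ge0_subset_integral => //; [exact: mIU|exact: mIU| |].
    exact: measurable_int (inh0 _ (mIU s)).
  by apply: setSI; apply: subset_itvl; rewrite bnd_simp.
have J0 s : 0 <= J s by apply: Rintegral_ge0.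
have Jle s : J s <= e / 3.
  apply/ltW/HI; first exact: mIU.
  apply: (@le_lt_trans _ _ (leb U)).
    by apply: le_measure; rewrite ?inE//; exact: mIU.
  by rewrite (lt_le_trans Udm)// lee_fin ge_min lexx orbT.
have JU r s : 0 <= r -> r <= s -> s <= t -> `]r, s] `<=` U -> 0 <= I s - I r + (J s - J r).
  move=> r0 rs st rsU.
  have mrs : measurable `]r, s]%classic by exact: measurable_itv.
  have E : `[0, s] `&` U = (`[0, r] `&` U) `|` `]r, s].
    apply/seteqP; split => z /=; rewrite !in_itv/=.
      move=> [/andP[z0 zs] zU]; have [zr|rz] := leP z r; first by left; rewrite z0.
      by right; rewrite zs.
    move=> [[/andP[z0 zr] zU]|zrs]; first by rewrite z0/= (le_trans zr).
    split; last exact: rsU.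
    by move: zrs => /andP[z1 ->]; rewrite andbT ltW// (le_lt_trans r0).
  have dj : [disjoint `[0, r] `&` U & `]r, s]%classic].
    apply/disj_setPS => z /= [[]]; rewrite !in_itv/= => /andP[z0 zr] _ /andP[].
    by rewrite ltNge zr.
  have -> : J s = J r + \int[leb]_(z in `]r, s]) `|h0 z|.
    by rewrite /J E Rintegral_setU//; [exact: mIU|rewrite -E; exact: (inh0 _ (mIU _))].
  have -> : I s - I r = \int[leb]_(z in `]r, s]) h0 z.
    rewrite /I Rintegral_itvB//; exact: ih0S.
  rewrite (addrC (J r)) addrK.
  have : `|\int[leb]_(z in `]r, s]) h0 z| <= \int[leb]_(z in `]r, s]) `|h0 z|.
    by apply: le_normr_Rintegral; [exact: mrs|exact: ih0S].
  by rewrite ler_norml -lerBlDr sub0r => /andP[].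
(* [V] is nonincreasing and [J] nondecreasing, so neither spoils the decrease of [Phi] at a point
   outside [N], where [G] and [I] each use half of the slope [e1]. The same monotonicity gives the
   semicontinuity from the right. *)
pose Phi s := G s + V s - I s - J s - e1 * s.
suff : Phi b <= Phi a.
  rewrite /Phi => Pab; have := Vle a a0; have := V0 b (le_trans a0 ab).
  have := Jle b; have := J0 a.
  have : e1 * (b - a) <= e / 3.
    have D0 : 0 < 1 + b - a by clear -ab; lra.
    rewrite /e1 invfM mulrA mulrAC ler_pdivrMr// ler_pM2l//; clear -ab; lra.
  clear -Pab; lra.
apply: left_nonincreasing => // [s as_ sb|s as_ sb e' e'0].
- have st : s <= t := le_trans sb bt.
  have s0 : 0 < s := le_lt_trans a0 as_.
  have [sN|sN] := pselect (N s).
    have : nbhs s U by apply: open_nbhs_nbhs; split => //; exact: NU.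
    rewrite -nbhs_ballE => -[dl /= dl0 sdl].
    exists dl => // r rs1 rs2 ar.
    have rsU : `]r, s] `<=` U.
      move=> z /=; rewrite in_itv/= => /andP[z1 z2].
      by apply: sdl; rewrite /ball/= ger0_norm; clear -rs1 z1 z2; lra.
    have r0 : 0 <= r := le_trans a0 ar.
    have := VU r s r0 (ltW rs2) st rsU; have := JU r s r0 (ltW rs2) st rsU.
    have := ler_norm (G s - G r).
    have : e1 * r <= e1 * s by rewrite ler_pM2l// ltW.
    rewrite /Phi; clear; lra.
  have nst : s != t by apply: contra_notN sN => /eqP ->; apply: NP; right.
  have sI : s \in `]0, t[ by rewrite in_itv/= s0 lt_neqAle nst.
  have [dG dI'] : left_dini_le G s (h s) /\ is_derive s 1 I (h s).
    have [//|nP] := pselect (left_dini_le G s (h s) /\ is_derive s 1 I (h s)).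
    by exfalso; apply: sN; apply: NP; left => /(_ sI).
  have [d1 d10 H1] := dG _ (divr_gt0 e10 (ltr0Sn R 1)).
  have [d2 d20 H2] := is_derive_left_quotient dI' (divr_gt0 e10 (ltr0Sn R 1)).
  exists (Num.min d1 d2); first by rewrite lt_min d10.
  move=> r; rewrite ltrBlDl -ltrBlDr lt_min => /andP[rd1 rd2] rs ar.
  have G1 : G s - G r <= (h s + e1 / 2) * (s - r).
    by apply: H1 => //; clear -rd1; lra.
  have /andP[G2 _] : (h s - e1 / 2) * (s - r) <= I s - I r <= (h s + e1 / 2) * (s - r).
    by apply: H2 => //; clear -rd2; lra.
  have r0 : 0 <= r := le_trans a0 ar.
  have := Vmono r s r0 (ltW rs); have := Jmono r s (ltW rs).
  have : (h s + e1 / 2) * (s - r) = (h s - e1 / 2) * (s - r) + e1 * (s - r) by field.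
  have : e1 * (s - r) = e1 * s - e1 * r by ring.
  rewrite /Phi; clear -G1 G2; lra.
- have := Icont; have := ACr_continuous aG.
  have s0 : 0 <= s := le_trans a0 as_.
  have hs0 : s \in `[0, t] by rewrite in_itv/= s0 ltW// (lt_le_trans sb).
  move=> /subspace_continuousP/(_ s hs0)/cvgrPdist_lt/(_ (e' / 2)) Gc.
  move=> /subspace_continuousP/(_ s hs0)/cvgrPdist_lt/(_ (e' / 2)) Ic.
  have e'2 : 0 < e' / 2 by rewrite divr_gt0.
  have : \forall r \near within `[0, t] (nbhs s),
      `|G s - G r| < e' / 2 /\ `|I s - I r| < e' / 2.
    by near=> r; split; near: r; [exact: Gc|exact: Ic].
  rewrite near_withinE -nbhs_ballE => -[dl /= dl0 Hdl].
  exists dl => // r sr rdl rb.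
  have rb' : ball s dl r by rewrite /ball/= distrC ger0_norm; clear -sr rdl; lra.
  have [|Gr Ir] := Hdl r rb'.
    by rewrite /= in_itv/= (le_trans s0 (ltW sr)) (le_trans rb).
  have := Vmono s r s0 (ltW sr); have := Jmono s r (ltW sr).
  have : e1 * s <= e1 * r by rewrite ler_pM2l// ltW.
  move: Gr Ir; rewrite !ltr_norml => /andP[g1 g2] /andP[i1 i2].
  rewrite /Phi; clear -g1 g2 i1 i2; lra.
Unshelve. all: by end_near. Qed.

End ACIntegral.

(** * Existence of flows *)

Section BoundedIntegral.
Context {R : realType}.
Local Notation leb := (@lebesgue_measure R).

Lemma bounded_integrable (phi : R -> R) (a b B : R) :
  measurable_fun `[a, b] phi -> (forall s, a <= s -> s <= b -> `|phi s| <= B) ->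
  leb.-integrable `[a, b] (EFin \o phi).
Proof.
move=> mphi phiB; apply: measurable_bounded_integrable => //.
- have [ab|ba] := leP a b; last by rewrite set_itv_ge ?measure0// -leNgt bnd_simp.
  by rewrite /= lebesgue_measure_itv/=; case: ifP => // _; rewrite -EFinD ltry.
- exists B; split; first exact: num_real.
  move=> x Bx s /=; rewrite in_itv/= => /andP[as_ sb].
  by rewrite (le_trans (phiB s as_ sb))// ltW.
Qed.

Lemma Rintegral_cst_itv (a b B : R) : a <= b -> \int[leb]_(s in `[a, b]) B = B * (b - a).
Proof.
move=> ab; rewrite Rintegral_cst//= lebesgue_measure_itv/= lte_fin.
case: ltP => [_|ba] //=.
by have -> : a = b; [apply/eqP; rewrite eq_le ab ba|rewrite subrr].
Qed.

Lemma Rintegral_bound (phi : R -> R) (a b B : R) : a <= b ->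
  measurable_fun `[a, b] phi -> (forall s, a <= s -> s <= b -> `|phi s| <= B) ->
  `|\int[leb]_(s in `[a, b]) phi s| <= B * (b - a).
Proof.
move=> ab mphi phiB; have iphi := bounded_integrable mphi phiB.
apply: le_trans (le_normr_Rintegral _ iphi) _ => //.
rewrite -Rintegral_cst_itv//; apply: le_Rintegral => //.
- have := integrable_abse iphi; exact.
- by apply: (@bounded_integrable _ _ _ `|B|) => //.
- by move=> s /=; rewrite in_itv/= => /andP[]; exact: phiB.
Qed.

End BoundedIntegral.

(** * Picard iteration for a bounded Lipschitz field *)

Section Picard.
Context {R : realType} {d : nat}.
Local Notation leb := (@lebesgue_measure R).
Variables (g : 'rV[R]_d -> 'rV[R]_d) (K M h : R).
Hypotheses (K0 : 0 < K) (M0 : 0 < M) (h0 : 0 < h) (Kh : K * h <= 2^-1).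
Hypothesis glip : forall x y, `|g x - g y| <= K * `|x - y|.
Hypothesis gbd : forall x, `|g x| <= M.
Variable x0 : 'rV[R]_d.

Lemma lipschitz_continuous (W V : normedModType R) (y : W -> V) (C : R) :
  (forall r s, `|y s - y r| <= C * `|s - r|) -> continuous y.
Proof.
move=> yC s; apply/cvgrPdist_le => e e0.
pose C1 := `|C| + 1; have C10 : 0 < C1 by rewrite ltr_wpDl.
apply/nbhs_ballP; exists (e / C1) => /=; first by rewrite divr_gt0.
move=> r; rewrite -ball_normE /= => /ltW sr.
rewrite (le_trans (yC _ _))//.
rewrite (@le_trans _ _ (C1 * `|s - r|))//.
  by rewrite ler_wpM2r// (le_trans (ler_norm _))// lerDl.
by rewrite -ler_pdivlMl// mulrC.
Qed.

(** For [s < 0] the interval of integration is empty and the value is [x0]; the iterates are thus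
    defined and Lipschitz on the whole line. *)
Definition picard_step (y : R -> 'rV[R]_d) (s : R) : 'rV[R]_d :=
  \row_i (x0 0 i + \int[leb]_(r in `[0, s]) g (y r) 0 i).

Definition picard (n : nat) : R -> 'rV[R]_d := iter n picard_step (cst x0).

Lemma g_coord_continuous (y : R -> 'rV[R]_d) i :
  continuous y -> continuous (fun r => g (y r) 0 i).
Proof.
move=> cy r; have cg : continuous g by exact: lipschitz_continuous (fun r s => glip s r).
apply: (@continuous_comp _ _ _ (g \o y) (fun z : 'rV[R]_d => z 0 i)).
  by apply: continuous_comp; [exact: cy|exact: cg].
exact: coord_continuous.
Qed.

Lemma g_coord_measurable (y : R -> 'rV[R]_d) i (D : set R) : measurable D ->
  continuous y -> measurable_fun D (fun r => g (y r) 0 i).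
Proof.
move=> mD cy; apply: (@measurable_funS _ _ _ _ setT) => //.
by apply: continuous_measurable_fun; exact: g_coord_continuous.
Qed.

Lemma g_coord_bound x i : `|g x 0 i| <= M.
Proof. exact: le_trans (mxnorm_coord _ _) (gbd x). Qed.

Lemma g_coord_integrable (y : R -> 'rV[R]_d) i a b : continuous y ->
  leb.-integrable `[a, b] (EFin \o (fun r => g (y r) 0 i)).
Proof.
move=> cy; apply: (@bounded_integrable _ _ _ _ M) => [|s _ _].
  exact: g_coord_measurable.
exact: g_coord_bound.
Qed.

Lemma picard_step_lipschitz (y : R -> 'rV[R]_d) : continuous y ->
  forall r s, `|picard_step y s - picard_step y r| <= M * `|s - r|.
Proof.
move=> cy r s; wlog rs : r s / r <= s => [H|].
  have [rs|sr] := leP r s; first exact: H.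
  by rewrite distrC (distrC s); apply: H; exact: ltW.
apply: mxnorm_leP => [|i]; first by rewrite mulr_ge0// ltW.
rewrite !mxE opprD addrACA subrr add0r (ger0_norm (x := s - r)) ?subr_ge0//.
have [s0|s0] := ltP s 0.
  rewrite !set_itv_ge ?bnd_simp -?ltNge//; last lra.
  by rewrite !Rintegral_set0 subrr normr0 mulr_ge0 ?subr_ge0// ltW.
have [r0|r0] := ltP r 0.
  rewrite (@set_itv_ge _ _ _ (BRight r)) ?bnd_simp -?ltNge//.
  rewrite Rintegral_set0 subr0.
  apply: (@le_trans _ _ (M * (s - 0))); last by rewrite ler_pM2l//; lra.
  apply: Rintegral_bound => // [|z _ _]; last exact: g_coord_bound.
  exact: g_coord_measurable.
rewrite Rintegral_itvB//; [|exact: g_coord_integrable..].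
rewrite Rintegral_itv_obnd_cbnd; last first.
  by apply: integrableS (@g_coord_integrable y i r s cy) => //; exact: subset_itv_oc_cc.
apply: Rintegral_bound => // [|z _ _]; last exact: g_coord_bound.
exact: g_coord_measurable.
Qed.

Lemma picard_continuous n : continuous (picard n).
Proof.
elim: n => [|n IH]; first by move=> s; exact: cvg_cst.
exact: lipschitz_continuous (picard_step_lipschitz IH).
Qed.

Lemma picard_lipschitz n r s : `|picard n s - picard n r| <= M * `|s - r|.
Proof.
case: n => [|n]; last exact: (picard_step_lipschitz (@picard_continuous n)).
by rewrite subrr normr0 mulr_ge0// ltW.
Qed.

Lemma picard_step_contract (y z : R -> 'rV[R]_d) (e : R) :
  continuous y -> continuous z -> (forall s, s <= h -> `|y s - z s| <= e) ->
  forall s, s <= h -> `|picard_step y s - picard_step z s| <= 2^-1 * e.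
Proof.
move=> cy cz yz s sh.
have e0 : 0 <= e := le_trans (normr_ge0 _) (yz s sh).
apply: mxnorm_leP => [|i]; first by rewrite mulr_ge0.
rewrite !mxE opprD addrACA subrr add0r.
have [s0|s0] := ltP s 0.
  by rewrite !set_itv_ge ?bnd_simp -?ltNge// !Rintegral_set0 subrr normr0 mulr_ge0.
rewrite -RintegralB//; [|exact: g_coord_integrable..].
apply: (@le_trans _ _ (K * e * (s - 0))); last first.
  rewrite subr0 mulrAC ler_wpM2r// (le_trans _ Kh)// ler_pM2l//.
apply: Rintegral_bound => // [|r _ rs].
  by apply: measurable_funB; exact: g_coord_measurable.
have -> : g (y r) 0 i - g (z r) 0 i = (g (y r) - g (z r)) 0 i by rewrite !mxE.
rewrite (le_trans (mxnorm_coord _ _))// (le_trans (glip _ _))// ler_pM2l//.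
by apply: yz; exact: le_trans sh.
Qed.

Lemma picard_cauchy n s : s <= h -> `|picard n.+1 s - picard n s| <= 2^-1 ^+ n * (M * h).
Proof.
elim: n s => [|n IH] s sh.
  rewrite expr0 mul1r /picard/=.
  have [s0|s0] := leP s 0.
    rewrite (_ : picard_step _ s = x0) ?subrr ?normr0 ?mulr_ge0 ?ltW//.
    apply/rowP => i; rewrite mxE.
    have [s00|s00] := eqVneq s 0; first by rewrite s00 set_itv1 Rintegral_set1 addr0.
    rewrite set_itv_ge ?Rintegral_set0 ?addr0// bnd_simp -ltNge lt_neqAle s00//.
  have := @picard_step_lipschitz (cst x0) (@picard_continuous 0%N) 0 s.
  rewrite subr0 (ger0_norm (ltW s0)).
  rewrite (_ : picard_step _ 0 = x0); last first.
    by apply/rowP => i; rewrite mxE set_itv1 Rintegral_set1 addr0.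
  by move=> /le_trans; apply; rewrite ler_pM2l.
rewrite exprS -mulrA; apply: (@picard_step_contract (picard n.+1) (picard n)) => //.
  exact: picard_continuous.
exact: picard_continuous.
Qed.

(** The tail of the geometric series of the increments bounded in [picard_cauchy]. *)
Let rate n := 2 * (2^-1 ^+ n * (M * h)).

Let rate_ge0 n : 0 <= rate n.
Proof. by rewrite /rate !mulr_ge0 ?exprn_ge0// ltW. Qed.

Let rate_small e : 0 < e -> exists n, rate n <= e.
Proof.
move=> e0; have c0 : 0 < 2 * (M * h) by rewrite !mulr_gt0.
have z1 : `|2^-1 : R| < 1 by rewrite ger0_norm// invf_lt1// ltr1n.
have := cvg_expr z1.
move=> /cvgrPdist_le /(_ (e / (2 * (M * h)))); rewrite divr_gt0// => /(_ isT).
move=> [N _ H]; exists N; have := H N (leqnn N).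
rewrite /= sub0r normrN ger0_norm ?exprn_ge0// ler_pdivlMr//.
by rewrite /rate; congr (_ <= _); ring.
Qed.

Lemma picard_dist n k s : s <= h -> `|picard (n + k) s - picard n s| <= rate n.
Proof.
move=> sh.
(* Subtracting the remaining tail [rate (n + k)] makes the bound telescope, so that the induction on
   [k] closes. *)
suff : `|picard (n + k) s - picard n s| <= rate n - rate (n + k).
  by move=> /le_trans; apply; rewrite lerBlDr lerDl.
elim: k => [|k IH]; first by rewrite addn0 !subrr normr0.
rewrite addnS -(subrKA (picard (n + k) s)).
apply: le_trans (ler_normD _ _) _.
apply: le_trans (lerD (picard_cauchy _ sh) IH) _.
by rewrite /rate exprS; lra.
Qed.

Lemma picard_solution : exists y : R -> 'rV[R]_d, [/\ y 0 = x0,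
  forall r s, `|y s - y r| <= M * `|s - r| &
  forall s, 0 < s -> s < h -> is_derive s 1 y (g (y s))].
Proof.
have cv s : cvgn (fun n => picard n (Num.min s h)).
  have sh : Num.min s h <= h by rewrite ge_min lexx orbT.
  apply/cauchy_cvgP; apply: cauchy_exP => e e0.
  have [|n nr] := @rate_small (e / 2); first by rewrite divr_gt0.
  exists (picard n (Num.min s h)); exists n => // k /= nk.
  rewrite -ball_normE/= distrC -(subnKC nk) (le_lt_trans (picard_dist _ _ sh))//.
  lra.
(* Convergence is guaranteed up to time [h] only; freezing the time there gives a limit that is
   Lipschitz on the whole line. *)
pose y s := limn (fun n => picard n (Num.min s h)).
have yr n s : `|y s - picard n (Num.min s h)| <= rate n.
  have sh : Num.min s h <= h by rewrite ge_min lexx orbT.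
  apply/ler_addgt0Pl => e e0.
  have /cvgrPdist_le/(_ e e0)[N _ HN] := cv s.
  have := HN (n + N)%N (leq_addl _ _) => /= H1.
  rewrite -(subrKA (picard (n + N) (Num.min s h))) (le_trans (ler_normD _ _))//.
  by rewrite lerD// picard_dist.
have ylip r s : `|y s - y r| <= M * `|s - r|.
  apply/ler_addgt0Pl => e e0; have [|n nr] := @rate_small (e / 2); first by rewrite divr_gt0.
  have H1 := yr n s; have H2 := yr n r; rewrite distrC in H2.
  have -> : y s - y r = (y s - picard n (Num.min s h)) +
      ((picard n (Num.min s h) - picard n (Num.min r h)) + (picard n (Num.min r h) - y r)).
    by rewrite !subrKA.
  apply: (@le_trans _ _ (rate n + (M * `|s - r| + rate n))).
    apply: le_trans (ler_normD _ _) _; apply: lerD => //.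
    apply: le_trans (ler_normD _ _) _; apply: lerD => //.
    rewrite (le_trans (picard_lipschitz _ _ _))// ler_pM2l//.
    have := ler_norm (s - r); have := ler_norm (r - s); rewrite (distrC r) ler_norml.
    by case: (leP s h) => sh; case: (leP r h) => rh; lra.
  lra.
have cy : continuous y by exact: lipschitz_continuous ylip.
have yfix s : s <= h -> y s = picard_step y s.
  move=> sh; apply/eqP; rewrite -subr_eq0 -normr_le0; apply/ler_addgt0Pl => e e0.
  rewrite addr0; have [|n nr] := @rate_small (e / 2); first by rewrite divr_gt0.
  have Hc : `|picard_step y s - picard_step (picard n) s| <= 2^-1 * rate n.
    apply: picard_step_contract => //; first exact: picard_continuous.
    by move=> r rh; have := yr n r; rewrite (min_l rh).
  have Hn := yr n.+1 s; rewrite (min_l sh) in Hn.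
  rewrite -(subrKA (picard n.+1 s)) (le_trans (ler_normD _ _))//.
  rewrite distrC in Hc.
  have : rate n.+1 = 2^-1 * rate n by rewrite /rate exprS; ring.
  move=> E; rewrite E in Hn.
  by rewrite (le_trans (lerD Hn Hc))//; have := rate_ge0 n; lra.
exists y; split => //.
  rewrite yfix; last exact: ltW.
  by apply/rowP => i; rewrite mxE set_itv1 Rintegral_set1 addr0.
move=> s s0 sh; apply: is_derive_row => i.
have [D DE] := @continuous_FTC1_closed R (fun r => g (y r) 0 i) 0 s h sh
  (g_coord_integrable i 0 h cy) s0 (@g_coord_continuous y i cy s).
have dF : is_derive s 1 (cst (x0 0 i) +
    (fun r : R => \int[leb]_(z in `[0, r]) g (y z) 0 i)) (0 + g (y s) 0 i).
  have dI : is_derive s 1 (fun r : R => \int[leb]_(z in `[0, r]) g (y z) 0 i) (g (y s) 0 i).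
    by apply: DeriveDef; [exact: D|rewrite -derive1E; exact: DE].
  exact: is_deriveD.
rewrite add0r in dF; move: dF; apply: near_eq_is_derive.
near=> r; rewrite [in RHS]yfix ?mxE//.
by apply: ltW; near: r; exact: lt_nbhsl.
Unshelve. all: by end_near. Qed.

End Picard.

(** * Lagrangian duality and convolutions *)

Section Lagrangian.
Context {R : realType} {d m : nat}.
Variables (f : 'I_m -> 'rV[R]_d -> 'rV[R]_d) (L : 'rV[R]_d -> 'rV[R]_m -> R).
Hypothesis HL : condL L.

Lemma Lagrangian_continuous : continuous (fun z : 'rV[R]_d * 'rV[R]_m => L z.1 z.2).
Proof. by case: HL => _ [dL _ _] _ _ z; exact: differentiable_continuous. Qed.

Lemma Lagrangian_periodic u : Zperiodic (fun x => L x u).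
Proof. by case: HL. Qed.

(** [A] is the radius where [K * r ^ (sigma - 1)] reaches [C]: beyond it the power dominates
    [C * r], and below it [C * A] does. *)
Lemma powR_superlinear (C K sigma : R) : 0 <= C -> 0 < K -> 1 < sigma ->
  exists2 D, 0 <= D & forall r, 0 <= r -> C * r - D <= K * r `^ sigma.
Proof.
move=> C0 K0 s1; pose B := C / K; have B0 : 0 <= B by rewrite divr_ge0// ltW.
pose A := B `^ (sigma - 1)^-1; have A0 : 0 <= A by exact: powR_ge0.
exists (C * A) => [|r r0]; first exact: mulr_ge0.
have [Ar|rA] := leP A r; last first.
  rewrite (@le_trans _ _ 0)// ?mulr_ge0 ?powR_ge0// ?(ltW K0)//.
  by rewrite subr_le0 ler_wpM2l// ltW.
rewrite (@le_trans _ _ (C * r))//; first by rewrite gerBl mulr_ge0.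
have -> : sigma = 1 + (sigma - 1) by rewrite addrC subrK.
rewrite powRD; last by apply/implyP => /eqP; lra.
rewrite powRr1// mulrCA [C * r]mulrC ler_wpM2l//.
have H : B <= r `^ (sigma - 1).
  have -> : B = A `^ (sigma - 1).
    by rewrite /A -powRrM mulVf ?powRr1//; lra.
  by apply: ge0_ler_powR => //; lra.
by rewrite mulrC -ler_pdivrMr.
Qed.

Lemma Lagrangian_coercive (C : R) : 0 <= C ->
  exists2 D, 0 <= D & forall x u, C * `|u| - D <= L x u.
Proof.
move=> C0; case: HL => _ _ _ [K1 [K2 [sigma [K10 s1 LK]]]].
have [D D0 HD] := powR_superlinear C0 K10 s1.
exists (D + `|K2|) => [|x u]; first by rewrite addr_ge0.
rewrite (le_trans _ (LK x u))//.
have := HD (enorm u) (sqrtr_ge0 _).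
have : C * `|u| <= C * enorm u by rewrite ler_wpM2l// mxnorm_le_enorm.
have := ler_norm K2; lra.
Qed.

Lemma dotv_le_bound n (q u : 'rV[R]_n) (C : R) : `|q| <= C ->
  dotv q u <= n%:R * C * `|u|.
Proof.
move=> qC; rewrite (le_trans (ler_dotv _ _))// mulrA ler_wpM2r//.
by rewrite ler_wpM2l.
Qed.

Lemma dotv_unit n (q : 'rV[R]_n) (e : R) i : dotv q (e *: ebasis i) = e * q 0 i.
Proof.
rewrite dotvZr /dotv (bigD1 i)//= big1 ?addr0 => [|j ji].
  by rewrite mxE !eqxx mulr1.
by rewrite mxE (negbTE ji) andbF mulr0.
Qed.

Lemma normr_ebasis n (e : R) (i : 'I_n) : `|e| <= 1 -> `|e *: (ebasis i : 'rV[R]_n)| <= 1.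
Proof.
move=> e1; apply: mxnorm_leP => // j; rewrite !mxE normrM.
by case: (_ && _); rewrite ?normr1 ?mulr1// normr0 mulr0.
Qed.

(** Testing the inequality with plus and minus the coordinate vectors bounds each entry of [q]. In
    the applications [q] is [p *m Fmat f y], so this controls the horizontal part of a gradient and
    not the gradient itself. *)
Lemma dual_bound (c : R) : exists2 C, 0 < C & forall y q,
  (forall u, dotv q u <= L y u - c) -> `|q| <= C.
Proof.
have [B B0 HB] := periodic_param_bounded Lagrangian_continuous Lagrangian_periodic 1.
exists (B + `|c|) => [|y q Hq]; first by rewrite ltr_wpDr.
apply: mxnorm_leP => [|i]; first by rewrite addr_ge0// ltW.
have H e : `|e| <= 1 -> e * q 0 i <= B + `|c|.
  move=> e1; rewrite -dotv_unit (le_trans (Hq _))//.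
  have := HB y (e *: ebasis i) (normr_ebasis i e1).
  have := ler_norm (L y (e *: ebasis i)); have := ler_norm (- c); rewrite normrN; lra.
rewrite ler_norml; have := H 1; have := H (-1).
by rewrite normrN normr1 => /(_ (lexx _)) h1 /(_ (lexx _)) h2; lra.
Qed.

(* For large controls coercivity absorbs everything; for bounded ones [L] is
   uniformly continuous in [x]. *)
Lemma dual_constraint_shift (c eta : R) : 0 < eta -> exists2 dl, 0 < dl &
  forall x y q q', `|x - y| <= dl -> `|q - q'| <= dl ->
    (forall u, dotv q u <= L y u - c) ->
    forall u, dotv q' u <= L x u - c + eta.
Proof.
move=> eta0; have [C C0 HC] := dual_bound c.
have M0 : 0 <= m%:R * (C + 1) :> R by rewrite mulr_ge0// addr_ge0// ltW.
have [|D D0 HD] := @Lagrangian_coercive (m%:R * (C + 1) + 1); first by rewrite addr_ge0.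
(* The slope of coercivity exceeds by one the bound [m * (C + 1)] for the pairing with [q']; the
   spare [|u|] outweighs [D + |c|] once [|u| > r]. *)
pose r := `|c| + D; have r0 : 0 <= r by rewrite addr_ge0.
have eta2 : 0 < eta / 2 by rewrite divr_gt0.
have [d1 d10 H1] := periodic_param_uniform Lagrangian_continuous
  Lagrangian_periodic r eta2.
have mr0 : 0 < m%:R * r + 1 :> R by rewrite ltr_wpDl// mulr_ge0.
pose d2 := eta / 2 / (m%:R * r + 1); have d20 : 0 < d2 by rewrite divr_gt0.
exists (Num.min 1 (Num.min d1 d2)); first by rewrite !lt_min ltr01 d10.
move=> x y q q'; rewrite !le_min => /and3P[_ xy _] /and3P[qq1 _ qq2] Hq u.
have [ur|ru] := leP `|u| r.
  have : dotv q' u <= dotv q u + eta / 2.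
    rewrite -lerBlDl -dotvBl.
    rewrite (le_trans (@dotv_le_bound _ _ _ d2 _))//; first by rewrite distrC.
    have mu : m%:R * `|u| <= m%:R * r + 1.
      by rewrite (@le_trans _ _ (m%:R * r)) ?lerDl// ler_wpM2l.
    rewrite mulrAC [leLHS]mulrC (le_trans (ler_wpM2l (ltW d20) mu))//.
    by rewrite /d2 divfK// gt_eqF.
  have := Hq u; have := H1 x y u ur xy; rewrite ler_norml => /andP[+ +]; lra.
have q'C : `|q'| <= C + 1.
  have -> : q' = q + (q' - q) by rewrite addrC subrK.
  by rewrite (le_trans (ler_normD _ _))// lerD// ?(HC _ _ Hq)// distrC.
rewrite (le_trans (dotv_le_bound _ q'C))//.
have := HD x u; have := ler_norm c; move: ru; rewrite /r.
rewrite mulrDl mul1r; lra.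
Qed.

(** The radius must not depend on [q], which is unbounded here. For [|q| <= C] coercivity excludes
    large controls; otherwise the signed coordinate vector along an entry larger than [C] already
    gives at least [-c], so the control may be taken of norm at most one. *)
Lemma dual_selection (c : R) : exists2 r, 0 < r & forall eta y q,
  0 < eta -> eta <= 1 ->
  (forall e, 0 < e -> exists u, - c - e <= dotv q u - L y u) ->
  exists2 u, `|u| <= r & - c - eta <= dotv q u - L y u.
Proof.
have [B B0 HB] := periodic_param_bounded Lagrangian_continuous Lagrangian_periodic 1.
pose C := B + `|c|; have C0 : 0 <= C by rewrite addr_ge0// ltW.
have M0 : 0 <= m%:R * C :> R by rewrite mulr_ge0.
have [|D D0 HD] := @Lagrangian_coercive (m%:R * C + 1); first by rewrite addr_ge0.
exists (D + `|c| + 1) => [|eta y q eta0 eta1 Hq].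
  by rewrite ltr_wpDl// addr_ge0.
have [qC|Cq] := leP `|q| C.
  have [u Hu] := Hq _ eta0; exists u => //.
  have := dotv_le_bound u qC; have := HD y u; have := ler_norm c.
  rewrite mulrDl mul1r; lra.
have [i Ci] : exists i, C < `|q 0 i|.
  apply/not_existsP => H; move: Cq; rewrite ltNge => /negP; apply.
  by apply: mxnorm_leP => // i; rewrite leNgt; exact/negP/H.
exists (Num.sg (q 0 i) *: ebasis i).
  rewrite (@le_trans _ _ 1)//; last by rewrite lerDr addr_ge0.
  by apply: normr_ebasis; rewrite normr_sg; case: (_ == _).
rewrite dotv_unit -normrEsg.
have sg1 : `|Num.sg (q 0 i)| <= 1 by rewrite normr_sg; case: (_ == _).
have := HB y _ (normr_ebasis i sg1); have := ler_norm (L y (Num.sg (q 0 i) *: ebasis i)).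
move: Ci; rewrite /C; have := ler_norm (- c); rewrite normrN; lra.
Qed.

Let hset x p := [set dotv (p *m Fmat f x) u - L x u | u in [set: 'rV[R]_m]].

Lemma Ham_has_sup x p : has_sup (hset x p).
Proof.
split; first by exists (dotv (p *m Fmat f x) 0 - L x 0), 0.
have [|D D0 HD] := @Lagrangian_coercive (m%:R * `|p *m Fmat f x|); first exact: mulr_ge0.
exists D => _ [u _ <-]; have := HD x u.
have := @dotv_le_bound _ (p *m Fmat f x) u _ (lexx _); lra.
Qed.

Lemma Ham_leP c x p :
  c + Ham f L x p <= 0 <-> forall u, dotv (p *m Fmat f x) u <= L x u - c.
Proof.
split=> [H u|H].
  have : dotv (p *m Fmat f x) u - L x u <= Ham f L x p.
    by apply: ub_le_sup; [case: (Ham_has_sup x p)|exists u].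
  lra.
have : Ham f L x p <= - c.
  apply: ge_sup; first by case: (Ham_has_sup x p).
  by move=> _ [u _ <-]; have := H u; lra.
lra.
Qed.

Lemma Ham_geP c x p : 0 <= c + Ham f L x p <->
  forall e, 0 < e -> exists u, - c - e <= dotv (p *m Fmat f x) u - L x u.
Proof.
split=> [H e e0|H].
  have [_ [u _ <-] Hu] := sup_adherent e0 (Ham_has_sup x p).
  exists u; apply/ltW/(le_lt_trans _ Hu); rewrite -/(Ham f L x p); lra.
apply/ler_addgt0Pr => e e0; have [u Hu] := H e e0.
have : dotv (p *m Fmat f x) u - L x u <= Ham f L x p.
  by apply: ub_le_sup; [case: (Ham_has_sup x p)|exists u].
lra.
Qed.

End Lagrangian.

(** * Quadratic penalties as test functions *)

Section QuadraticTest.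
Context {R : realType} {d : nat}.

(** The penalty uses the dot product rather than the sup norm carried by row vectors, so that it is
    smooth and admissible as a test function. *)
Definition quad (a : R) (x z : 'rV[R]_d) : R := a * dotv (x - z) (x - z).

Lemma quad_differentiable a x z : differentiable (quad a x) z.
Proof.
have dc i : differentiable (fun z : 'rV[R]_d => (x - z) 0 i) z.
  rewrite (_ : (fun z => _) = cst (x 0 i) - (fun z : 'rV[R]_d => z 0 i)).
    by apply: differentiableB; [exact: differentiable_cst|exact: differentiable_coord].
  by apply/funext => y; rewrite !mxE.
rewrite (_ : quad a x = \sum_i (cst a * ((fun z : 'rV[R]_d => (x - z) 0 i) *
    (fun z : 'rV[R]_d => (x - z) 0 i)))).
  apply: differentiable_sum => i; apply: differentiableM.
    exact: differentiable_cst.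
  exact: differentiableM.
apply/funext => y; rewrite /quad /dotv mulr_sumr fct_sumE.
by apply: eq_bigr.
Qed.

Lemma quad_expand a x z w :
  quad a x (z + w) = quad a x z + 2 * a * dotv (z - x) w + a * dotv w w.
Proof.
rewrite /quad -(dotvN (x - (z + w))) -(dotvN (x - z)) !opprB addrAC dotvDD; ring.
Qed.

Lemma is_derive_quad a x z w : is_derive z w (quad a x) (2 * a * dotv (z - x) w).
Proof.
have H : h^-1 *: (quad a x (h *: w + z) - quad a x z) @[h --> 0^'] -->
    2 * a * dotv (z - x) w.
  apply: (@cvg_trans _ ((fun h : R => 2 * a * dotv (z - x) w + h * (a * dotv w w)) @ 0^')).
    apply: near_eq_cvg; near=> h.
    have h0 : h != 0 by near: h; exact: nbhs_dnbhs_neq.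
    rewrite (addrC (h *: w)) quad_expand dotvZr dotvZl dotvZr /GRing.scale/=; field.
    exact: h0.
  have : 2 * a * dotv (z - x) w + h * (a * dotv w w) @[h --> 0^'] -->
      2 * a * dotv (z - x) w + 0 * (a * dotv w w).
    apply: cvgD; first exact: cvg_cst.
    by apply: cvgM; [apply: cvg_within_filter; exact: cvg_id|exact: cvg_cst].
  by rewrite mul0r addr0.
by apply: DeriveDef; [apply/cvg_ex; eexists; exact: H|exact: cvg_lim H].
Unshelve. all: by end_near. Qed.

Lemma grad_quad a x z : grad (quad a x) z = (2 * a) *: (z - x).
Proof.
apply/rowP => i; have [_ E] := is_derive_quad a x z (ebasis i).
by rewrite mxE E -[ebasis i]scale1r dotv_unit mul1r !mxE.
Qed.

Lemma C1_quad a x : C1 (quad a x).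
Proof.
split=> [z|i]; first exact: quad_differentiable.
rewrite (_ : 'D_(ebasis i) (quad a x) = fun z => 2 * a * (z - x) 0 i).
  move=> z; apply: (@continuousM R _ (cst (2 * a)) (fun z : 'rV[R]_d => (z - x) 0 i)).
    exact: cst_continuous.
  apply: (@continuous_comp _ _ _ (fun z : 'rV[R]_d => z - x) (fun z : 'rV[R]_d => z 0 i)).
    exact: differentiable_continuous.
  exact: coord_continuous.
apply/funext => z; have [_ ->] := is_derive_quad a x z (ebasis i).
by rewrite -[ebasis i]scale1r dotv_unit mul1r.
Qed.

End QuadraticTest.

Section SupConvolution.
Context {R : realType} {d : nat}.

(** With [k = 2B / r^2] the penalty beyond distance [r] exceeds the oscillation of [w], so a
    maximizer over the ball of radius [r] is a global one. Comparison with [y = x] then bounds the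
    penalty by [w y - w x], which the modulus of continuity makes small. This last bound is the one
    that tames the gradient of the penalty. *)
Lemma sup_convolution (w : 'rV[R]_d -> R) (eta : R) :
  continuous w -> Zperiodic w -> 0 < eta ->
  exists2 k, 0 < k & forall x, exists y,
    [/\ forall z, w z - quad k x z <= w y - quad k x y, `|x - y| <= eta &
        quad k x y <= eta].
Proof.
move=> cw pw eta0.
have [B B0 HB] := periodic_bounded cw pw.
have [dl dl0 Hdl] := periodic_uniform cw pw eta0.
pose r := Num.min dl eta; have r0 : 0 < r by rewrite lt_min dl0.
pose k := 2 * B / r ^+ 2; have k0 : 0 < k by rewrite divr_gt0 ?mulr_gt0// exprn_gt0.
exists k => // x.
pose A := [set z : 'rV[R]_d | `|z| <= r].
pose g z := w (x + z) - k * dotv z z.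
have cg : {within A, continuous g}.
  have -> : g = (w \o (fun z : 'rV[R]_d => x + z)) - quad k 0.
    by apply/funext => z; rewrite /g -[dotv z z]dotvN -[- z]sub0r.
  apply: continuous_subspaceT => z; apply: continuousB.
    apply: continuous_comp; last exact: cw.
    exact: differentiable_continuous.
  exact/differentiable_continuous/quad_differentiable.
have A0 : A !=set0 by exists 0; rewrite /A/= normr0 ltW.
have [y0] := EVT_max_rV A0 (@closed_mxball_compact R d r) cg.
rewrite inE /A/= => y0r Hmax.
exists (x + y0).
have Ey : quad k x (x + y0) = k * dotv y0 y0.
  by rewrite /quad opprD addrA subrr add0r dotvN.
have Hx : w x <= w (x + y0) - k * dotv y0 y0.
  have := Hmax 0; rewrite inE /A/= normr0 => /(_ (ltW r0)).
  by rewrite /g addr0 dotv0l mulr0 subr0.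
have dy : `|x - (x + y0)| <= r by rewrite opprD addrA subrr add0r normrN.
rewrite Ey; split.
- move=> z; have [zr|rz] := leP `|z - x| r.
    have := Hmax (z - x); rewrite inE => /(_ zr).
    by rewrite /g (addrC x (z - x)) subrK /quad -(dotvN (x - z)) opprB.
  rewrite (le_trans _ Hx)//.
  have : k * r ^+ 2 <= quad k x z.
    rewrite /quad ler_pM2l// (le_trans _ (sqr_mxnorm_le_dotv _))//.
    by rewrite distrC in rz; rewrite lerXn2r ?nnegrE ?(ltW r0)// ltW.
  have kr : k * r ^+ 2 = 2 * B by rewrite /k; field; rewrite gt_eqF.
  rewrite kr; have := HB z; have := HB x; rewrite !ler_norml => /andP[+ _] /andP[_ +]; lra.
- by rewrite (le_trans dy)// ge_min lexx orbT.
have : `|x - (x + y0)| <= dl by rewrite (le_trans dy)// ge_min lexx.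
by move=> /Hdl; rewrite ler_norml => /andP[+ _]; lra.
Qed.

End SupConvolution.

(** * Subsolutions *)

Section Curves.
Context {R : realType} {d : nat}.
Local Notation leb := (@lebesgue_measure R).
Implicit Types (g : R -> 'rV[R]_d) (t : R).

(** The Lipschitz bound is needed only on a set containing the curve, which suits test functions
    controlled near a point, and only at distance at most one, which suits sup-convolutions; the
    modulus for [Num.min 1 (e / C)] keeps every increment below one. *)
Lemma AC_comp_lipschitz g t (S : set 'rV[R]_d) (phi : 'rV[R]_d -> R) (C : R) :
  Defs.AC g t -> (forall s, 0 <= s -> s <= t -> S (g s)) -> 0 < C ->
  (forall x y, S x -> S y -> `|x - y| <= 1 -> `|phi x - phi y| <= C * `|x - y|) ->
  ACr (phi \o g) t.
Proof.
move=> ag gS C0 phiC e e0.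
have [|dl [dl0 H]] := ag (Num.min 1 (e / C)); first by rewrite lt_min ltr01 divr_gt0.
exists dl; split => // n ab ab1 ab2 ab3.
have := H n ab ab1 ab2 ab3; rewrite lt_min => /andP[s1 s2].
apply: (@le_lt_trans _ _ (\sum_k C * `|g (ab k).2 - g (ab k).1|)); last first.
  by rewrite -mulr_sumr mulrC -ltr_pdivlMr.
apply: ler_sum => k _; have [k0 [k1 k2]] := ab1 k.
apply: phiC.
- by apply: gS => //; exact: le_trans k1.
- by apply: gS => //; exact: le_trans k2.
- apply: le_trans (ltW s1); rewrite (bigD1 k)//= lerDl.
  by apply: sumr_ge0.
Qed.

Lemma AC_coord g t i : Defs.AC g t -> ACr (fun s => g s 0 i) t.
Proof.
move=> ag; apply: (@AC_comp_lipschitz g t setT (fun x => x 0 i) 1) => // x y _ _ _.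
by rewrite mul1r (le_trans _ (mxnorm_coord (x - y) i))// !mxE.
Qed.

Lemma AC_coord_measurable g t i : Defs.AC g t -> measurable_fun `[0, t] (fun s => g s 0 i).
Proof.
move=> ag; apply: subspace_continuous_measurable_fun => //.
exact: ACr_continuous (AC_coord i ag).
Qed.

Lemma lipschitz_AC g t (M : R) : 0 < M ->
  (forall r s, `|g s - g r| <= M * `|s - r|) -> Defs.AC g t.
Proof.
move=> M0 gM e e0; exists (e / M); split; first exact: divr_gt0.
move=> n ab ab1 _ abs; apply: (@le_lt_trans _ _ (\sum_k M * ((ab k).2 - (ab k).1))).
  apply: ler_sum => k _; rewrite (le_trans (gM _ _))// ger0_norm// subr_ge0.
  by have [_ []] := ab1 k.
by rewrite -mulr_sumr mulrC -ltr_pdivlMr.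
Qed.

Lemma diff_dotv_grad (phi : 'rV[R]_d -> R) x w : differentiable phi x ->
  'd phi x w = dotv (grad phi x) w.
Proof.
move=> dphi; rewrite [w in LHS]row_sum_delta linear_sum /dotv.
by apply: eq_bigr => i _; rewrite linearZ -deriveE// mxE mulrC.
Qed.

Lemma left_dini_le_mono (g1 g2 : R -> R) s (c1 c2 : R) :
  (forall r, g1 s - g1 r <= g2 s - g2 r) -> c1 <= c2 ->
  left_dini_le g2 s c1 -> left_dini_le g1 s c2.
Proof.
move=> g12 c12 H e e0; have [dl dl0 Hdl] := H e e0; exists dl => // r r1 r2.
rewrite (le_trans (g12 r))// (le_trans (Hdl r r1 r2))// ler_wpM2r ?lerD2r//.
by rewrite subr_ge0 ltW.
Qed.

(** The negative part is at most [D] on a bounded interval, so an integral below [+oo] is finite.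
    This passes from extended costs to real integrals. *)
Lemma integrable_lower_bounded (l : R -> R) (t D : R) : 0 <= D ->
  measurable_fun `[0, t] l -> (forall s, - D <= l s) ->
  (\int[leb]_(s in `[0%R, t]) (l s)%:E < +oo)%E ->
  leb.-integrable `[0, t] (EFin \o l).
Proof.
move=> D0 ml lD loo; apply/integrableP; split; first exact/measurable_EFinP.
rewrite [ltLHS](_ : _ = \int[leb]_(s in `[0%R, t]) `|(l s)%:E|)%E//.
rewrite integral_fin_num_abs//.
have iD : leb.-integrable `[0, t] (EFin \o cst D).
  by apply: (@bounded_integrable _ _ _ _ `|D|) => //.
have nfin : (\int[leb]_(x in `[0%R, t]) ((EFin \o l)^\- x) < +oo)%E.
  apply: (@le_lt_trans _ _ (\int[leb]_(x in `[0%R, t]) (EFin \o cst D) x)%E); last first.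
    by apply: integrable_lty => //.
  apply: ge0_le_integral => //.
  - by apply: measurable_funeneg; exact/measurable_EFinP.
  - exact/measurable_EFinP.
  - by move=> s _; rewrite funenegE ge_max !lee_fin D0 andbT lerNl.
have nge0 : (0 <= \int[leb]_(x in `[0%R, t]) ((EFin \o l)^\- x))%E by exact: integral_ge0.
rewrite fin_numElt loo andbT integralE.
apply: (@lt_le_trans _ _ (0 - \int[leb]_(x in `[0%R, t]) ((EFin \o l)^\- x))%E).
  have nfn : (\int[leb]_(x in `[0%R, t]) ((EFin \o l)^\- x))%E \is a fin_num.
    by rewrite ge0_fin_numE.
  by rewrite sub0e -(fineK nfn) -EFinN ltNyr.
by apply: leeD2r; exact: integral_ge0.
Qed.

Lemma integrable_addr_cst (l : R -> R) (t e : R) :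
  leb.-integrable `[0, t] (EFin \o l) ->
  leb.-integrable `[0, t] (EFin \o (fun s => l s + e)).
Proof.
move=> il; have ie : leb.-integrable `[0, t] (EFin \o cst e).
  by apply: (@bounded_integrable _ _ _ _ `|e|) => //.
have : leb.-integrable `[0, t] ((EFin \o l) \+ (EFin \o cst e))%E by exact: integrableD.
by apply: eq_integrable.
Qed.

Lemma Rintegral_addr_cst (l : R -> R) (t e : R) : 0 <= t ->
  leb.-integrable `[0, t] (EFin \o l) ->
  \int[leb]_(s in `[0, t]) (l s + e) = \int[leb]_(s in `[0, t]) l s + e * t.
Proof.
move=> t0 il; have ie : leb.-integrable `[0, t] (EFin \o cst e).
  by apply: (@bounded_integrable _ _ _ _ `|e|) => //.
by rewrite RintegralD// Rintegral_cst_itv// subr0.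
Qed.

End Curves.

Section Subsolution.
Context {R : realType} {d m : nat}.
Local Notation leb := (@lebesgue_measure R).
Variables (f : 'I_m -> 'rV[R]_d -> 'rV[R]_d) (L : 'rV[R]_d -> 'rV[R]_m -> R).
Hypotheses (fsmooth : forall i, smooth (f i)) (fper : forall i, Zperiodic (f i)).
Hypothesis HL : condL L.

Lemma running_cost_measurable t g u : Defs.AC g t -> L2 u t ->
  measurable_fun `[0, t] (fun s => L (g s) (u s)).
Proof.
move=> ag [mu _]; apply: measurable_fun_continuous_coord2 => //.
  exact: Lagrangian_continuous HL.
by move=> j; exact: AC_coord_measurable.
Qed.

Lemma running_cost_integrable t g u : Defs.AC g t -> L2 u t ->
  (cost L t g u < +oo)%E -> leb.-integrable `[0, t] (EFin \o (fun s => L (g s) (u s))).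
Proof.
move=> ag au; have [D D0 HD] := Lagrangian_coercive HL (lexx 0).
apply: (integrable_lower_bounded D0); first exact: running_cost_measurable.
by move=> s; have := HD (g s) (u s); rewrite mul0r sub0r.
Qed.

Lemma costE t g u : leb.-integrable `[0, t] (EFin \o (fun s => L (g s) (u s))) ->
  cost L t g u = (\int[leb]_(s in `[0, t]) L (g s) (u s))%:E.
Proof. by move=> il; rewrite /Rintegral fineK//; exact: integrable_fin_num. Qed.

(** When [p] is the gradient of a penalty between [x] and [y], the product of norms on the right is
    of the order of the penalty itself, hence small. *)
Lemma mulmx_Fmat_shift (p x y : 'rV[R]_d) (K : R) :
  (forall x y u, `|Fu f x u - Fu f y u| <= K * (`|x - y| * `|u|)) -> 0 <= K ->
  `|p *m Fmat f y - p *m Fmat f x| <= d%:R * (K * (`|p| * `|x - y|)).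
Proof.
move=> HK K0; apply: mxnorm_leP => [|j]; first by rewrite !mulr_ge0.
have H z : (p *m Fmat f z) 0 j = dotv p (Fu f z (ebasis j)).
  by rewrite -dotv_mulmx_Fmat -[ebasis j]scale1r dotv_unit mul1r.
rewrite mxE [X in _ + X]mxE !H -dotvBr (le_trans (ler_normr_dotv _ _))//.
rewrite ler_wpM2l// (mulrCA K) ler_wpM2l// (le_trans (HK _ _ _))//.
rewrite (distrC y) ler_wpM2l// ler_piMr//.
by rewrite -[ebasis j]scale1r normr_ebasis// normr1.
Qed.

Variables (c : R) (v : 'rV[R]_d -> R).
Hypotheses (vcont : continuous v) (vper : Zperiodic v).

(* The maximizer [Y x] carries the viscosity inequality, which is then moved back
   to [x]. *)
Lemma subsolution_approx (eta : R) : 0 < eta -> visc_sub c f L v ->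
  exists (V : 'rV[R]_d -> R) (Y : 'rV[R]_d -> 'rV[R]_d) (k C : R),
  [/\ 0 < k, 0 < C,
    forall x, v x <= V x <= v x + eta,
    forall x y, `|x - y| <= 1 -> `|V x - V y| <= C * `|x - y| &
    forall x, (forall z, V x - V z <= quad k z (Y x) - quad k x (Y x)) /\
      forall u, dotv ((2 * k) *: (Y x - x)) (Fu f x u) <= L x u - c + eta].
Proof.
move=> eta0 vsub.
have [K K0 HK] := Fu_lipschitz fsmooth fper.
have [dl dl0 Hdl] := dual_constraint_shift HL c eta0.
have [dv dv0 Hdv] := periodic_uniform vcont vper eta0.
have dK0 : 0 < 2 * d%:R * K + 1 by rewrite ltr_wpDl// !mulr_ge0// ltW.
(* The three bounds serve the closeness of [V] to [v], the displacement of the base point from [Y x]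
   to [x], and that of the covector, at most [2 * d * K * eta']. *)
pose eta' := Num.min dv (Num.min dl (dl / (2 * d%:R * K + 1))).
have eta'0 : 0 < eta' by rewrite !lt_min dv0 dl0 divr_gt0.
have [k k0 /choice[Y HY]] := sup_convolution vcont vper eta'0.
have e1 : eta' <= dv by rewrite ge_min lexx.
have e2 : eta' <= dl by rewrite !ge_min lexx orbT.
have e3 : (2 * d%:R * K + 1) * eta' <= dl.
  by rewrite mulrC -ler_pdivlMr// !ge_min lexx !orbT.
pose V x := v (Y x) - quad k x (Y x).
have VE x z : V x - V z <= quad k z (Y x) - quad k x (Y x).
  by have [H _ _] := HY z; have := H (Y x); rewrite /V; lra.
have quad0 x y : 0 <= quad k x y by rewrite mulr_ge0 ?dotv_ge0// ltW.
have quadxx x : quad k x x = 0 by rewrite /quad subrr dotv0l mulr0.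
(* The Lipschitz constant comes from expanding the square [|y - Y x|^2] around [x] for
   [|x - y| <= 1]; the final 1 makes it positive. *)
exists V, Y, k, (k * d%:R * (2 * eta' + 1) + 1); split => //.
- by rewrite ltr_wpDl// !mulr_ge0// ?addr_ge0 ?mulr_ge0// ltW.
- move=> x; have [H1 H2 _] := HY x; apply/andP; split.
    by have := H1 x; rewrite quadxx subr0.
  rewrite /V lerBlDr (@le_trans _ _ (v x + eta)) ?lerDl//.
  have : `|x - Y x| <= dv by exact: le_trans e1.
  by move=> /Hdv; rewrite ler_norml => /andP[+ _]; lra.
- suff H x y : `|x - y| <= 1 -> V x - V y <= (k * d%:R * (2 * eta' + 1) + 1) * `|x - y|.
    move=> x y xy; rewrite ler_norml H// andbT lerNl opprB distrC.
    by apply: H; rewrite distrC.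
  move=> xy; apply: (le_trans (VE x y)).
  have [_ H2 _] := HY x.
  have -> : quad k y (Y x) - quad k x (Y x) =
      k * (2 * dotv (x - Y x) (y - x) + dotv (y - x) (y - x)).
    rewrite /quad (_ : y - Y x = (x - Y x) + (y - x)); last by rewrite [RHS]addrC subrKA.
    by rewrite (dotvDD (x - Y x)); ring.
  rewrite (_ : _ * `|x - y| = k * (d%:R * (2 * eta' + 1) * `|x - y|) + `|x - y|); last by ring.
  rewrite ler_wpDr// ler_pM2l//.
  have h1 := ler_dotv (x - Y x) (y - x); have h2 := ler_dotv (y - x) (y - x).
  rewrite (distrC y x) in h1 h2.
  have h3 : d%:R * (`|x - Y x| * `|x - y|) <= d%:R * (eta' * `|x - y|).
    by rewrite ler_wpM2l// ler_wpM2r.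
  have h4 : d%:R * (`|x - y| * `|x - y|) <= d%:R * `|x - y|.
    by rewrite ler_wpM2l// ler_piMl.
  rewrite (_ : d%:R * _ * _ = 2 * (d%:R * (eta' * `|x - y|)) + d%:R * `|x - y|); last by ring.
  lra.
- move=> x; split => [z|u]; first exact: VE.
  have [H1 H2 H3] := HY x.
  rewrite -dotv_mulmx_Fmat; set p := (2 * k) *: _.
  have := vsub (quad k x) (Y x) (C1_quad k x); rewrite grad_quad -/p => Hs.
  have /(Ham_leP f HL) Hq : c + Ham f L (Y x) p <= 0 by apply: Hs; near=> z; exact: H1.
  apply: (Hdl x (Y x) (p *m Fmat f (Y x))) => //; first exact: le_trans e2.
  rewrite (le_trans (mulmx_Fmat_shift p x (Y x) HK (ltW K0)))//.
  rewrite /p normrZ ger0_norm; last by rewrite mulr_ge0// ltW.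
  apply: le_trans e3.
  rewrite (_ : _ * eta' = 2 * d%:R * K * eta' + eta'); last by ring.
  rewrite ler_wpDr ?(ltW eta'0)//.
  have H4 : k * (`|x - Y x| * `|x - Y x|) <= eta'.
    by apply: le_trans H3; rewrite ler_pM2l// -expr2 sqr_mxnorm_le_dotv.
  rewrite (distrC (Y x)).
  rewrite (_ : d%:R * _ = 2 * d%:R * K * (k * (`|x - Y x| * `|x - Y x|))); last by ring.
  by rewrite ler_wpM2l// !mulr_ge0// ltW.
Unshelve. all: by end_near. Qed.

Lemma subsolution_le_cost t g u : 0 <= t -> visc_sub c f L v ->
  admissible f t g u -> ((v (g t) + c * t)%:E <= (v (g 0))%:E + cost L t g u)%E.
Proof.
move=> t0 vsub [ag au ae].
have [coo|] := ltP (cost L t g u) +oo%E; last first.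
  by rewrite leye_eq => /eqP ->; rewrite addey// leey.
have il := running_cost_integrable ag au coo.
rewrite costE// -EFinD lee_fin.
apply/ler_addgt0Pl => e e0.
(* The losses are [t * eta] along the curve and one [eta] for replacing [V] by [v] at the starting
   point. *)
have t20 : 0 < t + 2 by lra.
have [V [Y [k [C [k0 C0 vV VC HV]]]]] := subsolution_approx (divr_gt0 e0 t20) vsub.
set eta := e / (t + 2) in vV HV.

have H : V (g t) - V (g 0) <= \int[leb]_(s in `[0, t]) (L (g s) (u s) + (eta - c)).
  apply: (@ACr_le_integral _ (V \o g) (fun s => L (g s) (u s) + (eta - c)) t 0 t) => //.
  - by apply: (@AC_comp_lipschitz _ _ g t setT V C) => // x y _ _; exact: VC.
  - exact: integrable_addr_cst.
  move: ae; apply: filterS; first exact: (ae_filter_ringOfSetsType leb).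
  move=> s Hs st; have {Hs st} ds : is_derive s 1 g (Fu f (g s) (u s)).
    by apply: Hs; move: st; rewrite !in_itv/= => /andP[/ltW -> /ltW ->].
  have [V1 V2] := HV (g s).
  (* Up to a constant, [psi] touches [V] from below at [g s]; the chain rule is needed only for this
     quadratic, not for [V]. *)
  pose psi := fun z => quad (- k) (Y (g s)) z.
  apply: (@left_dini_le_mono _ (V \o g) (psi \o g) s
    (dotv ((2 * k) *: (Y (g s) - g s)) (Fu f (g s) (u s)))).
  - move=> r; rewrite (le_trans (V1 (g r)))// /psi /quad /=.
    rewrite -(dotvN (g r - _)) -(dotvN (g s - _)) !opprB; lra.
  - by have := V2 (u s); lra.
  apply: is_derive_left_dini_le.
  have -> : dotv ((2 * k) *: (Y (g s) - g s)) (Fu f (g s) (u s)) =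
      'd psi (g s) (Fu f (g s) (u s)).
    rewrite diff_dotv_grad; last exact: quad_differentiable.
    by rewrite grad_quad -(opprB (g s)) scalerN -scaleNr mulrN.
  by apply: is_derive_comp_diff => //; exact: quad_differentiable.
rewrite Rintegral_addr_cst// in H.
have /andP[v1 _] := vV (g t); have /andP[_ v2] := vV (g 0).
have : eta * (t + 2) = e by rewrite /eta divfK// gt_eqF.
have : 0 < eta by rewrite divr_gt0.
lra.
Qed.

End Subsolution.

(** * Supersolutions *)

Section Supersolution.
Context {R : realType} {d m : nat}.
Local Notation leb := (@lebesgue_measure R).
Variables (f : 'I_m -> 'rV[R]_d -> 'rV[R]_d) (L : 'rV[R]_d -> 'rV[R]_m -> R).
Hypotheses (fsmooth : forall i, smooth (f i)) (fper : forall i, Zperiodic (f i)).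
Hypothesis HL : condL L.

Lemma is_derive_affine (a b s : R) : is_derive s 1 (fun z : R => a + b * z) b.
Proof.
rewrite (_ : (fun z => _) = cst a + b \*: id); last exact/funext.
by apply: is_derive_eq; rewrite add0r [_ *: _]mulr1.
Qed.

(** The flow of the control [-u] is started at [x] and run in reversed time. The last estimate, from
    the mean value theorem in each coordinate, is a first-order expansion whose error is uniform in
    [x] and in bounded [u]. *)
Lemma backward_flow (r : R) : 0 < r -> exists (h M K : R), [/\ 0 < h, 0 < M, 0 < K &
  forall h' u x, 0 < h' -> h' <= h -> `|u| <= r -> exists g : R -> 'rV[R]_d,
  [/\ g h' = x, forall a b, `|g b - g a| <= M * `|b - a|,
      forall s, 0 < s -> s < h' -> is_derive s 1 g (Fu f (g s) u) &
      `|g 0 - x + h' *: Fu f x u| <= K * h' ^+ 2]].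
Proof.
move=> r0; have [K K0 HK] := Fu_lipschitz fsmooth fper.
have [M M0 HM] := Fu_bounded fsmooth fper.
have Kr0 : 0 < K * r by rewrite mulr_gt0.
have Mr0 : 0 < M * r by rewrite mulr_gt0.
(* The longest time for which the Picard step contracts by one half, the speed, and the Lipschitz
   constant of the field times the speed. *)
exists (2^-1 / (K * r)), (M * r), (K * r * (M * r)); split => //.
- by rewrite divr_gt0.
- by rewrite mulr_gt0.
move=> h u x h0 hh ur.
have lipF y z : `|Fu f y (- u) - Fu f z (- u)| <= K * r * `|y - z|.
  rewrite (le_trans (HK _ _ _))// normrN -mulrA ler_pM2l// mulrC.
  by rewrite ler_wpM2r.
have bdF y : `|Fu f y (- u)| <= M * r.
  by rewrite (le_trans (HM _ _))// normrN ler_pM2l.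
have Kh : K * r * h <= 2^-1 by rewrite mulrC -ler_pdivlMr.
have [y [y0 ylip yD]] := picard_solution Kr0 Mr0 h0 Kh lipF bdF x.
exists (fun s => y (h - s)); split.
- by rewrite subrr.
- move=> a b; rewrite (le_trans (ylip _ _))//.
  by rewrite (_ : h - b - (h - a) = a - b) 1?distrC//; ring.
- move=> s s0 sh.
  have hs : is_derive s 1 (fun s : R => h - s) (- 1).
    rewrite (_ : (fun s : R => h - s) = (fun s => h + -1 * s)).
      exact: is_derive_affine.
    by apply/funext => z; rewrite mulN1r.
  have h1 : 0 < h - s by rewrite subr_gt0.
  have h2 : h - s < h by rewrite gtrBl.
  have dy := yD _ h1 h2.
  have dfy : differentiable y (h - s) by apply/derivable1_diffP; case: dy.
  have := is_derive_comp_diff hs dfy.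
  have -> // : 'd y (h - s) (- 1) = Fu f (y (h - s)) u.
  rewrite linearN -deriveE//; case: dy => _ ->.
  by rewrite FuN opprK.
rewrite subr0; apply: mxnorm_leP => [|i].
  by rewrite !mulr_ge0 ?exprn_ge0// ltW.
have dyi s : s \in `]0, h[ ->
    is_derive s 1 (fun s => y s 0 i) (Fu f (y s) (- u) 0 i).
  by rewrite in_itv/= => /andP[s0 sh]; exact/is_derive_coord/yD.
have cy : {within `[0, h], continuous (fun s => y s 0 i)}.
  apply: continuous_subspaceT => s.
  apply: (@continuous_comp _ _ _ y (fun z : 'rV[R]_d => z 0 i)).
    have cy0 : continuous y by exact: lipschitz_continuous ylip.
    exact: cy0.
  exact: coord_continuous.
have [z] := MVT h0 dyi cy; rewrite in_itv/= subr0 y0 => /andP[z0 zh] Ey.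
rewrite !mxE Ey -[Fu f x u]opprK -FuN mxE mulrN mulrC -mulrBr normrM gtr0_norm//.
have -> : Fu f (y z) (- u) 0 i - Fu f x (- u) 0 i = (Fu f (y z) (- u) - Fu f x (- u)) 0 i.
  by rewrite !mxE.
rewrite (_ : _ * h ^+ 2 = h * (K * r * (M * r * h))); last by ring.
rewrite ler_pM2l// (le_trans (mxnorm_coord _ _))//.
rewrite (le_trans (lipF _ _))// ler_pM2l// -y0 (le_trans (ylip _ _))//.
by rewrite subr0 ler_pM2l// gtr0_norm// ltW.
Qed.

Lemma ae_neq (a : R) : {ae leb, forall s : R, s != a}.
Proof.
exists [set a]; split => //; first exact: lebesgue_measure_set1.
by move=> s /= /negP; rewrite negbK => /eqP.
Qed.

(** A strong form of admissibility with bounds uniform over all pieces, which survives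
    concatenation. The equation is required on the open interval only, so that end points need no
    attention. *)
Definition controlled (M r T : R) (g : R -> 'rV[R]_d) (u : R -> 'rV[R]_m) :=
  [/\ forall a b, `|g b - g a| <= M * `|b - a|,
      forall j, measurable_fun setT (fun s => u s 0 j),
      forall s, `|u s| <= r &
      {ae leb, forall s, s \in `]0, T[ -> is_derive s 1 g (Fu f (g s) (u s))}].

Lemma controlled_admissible M r T g u : 0 < M ->
  controlled M r T g u -> admissible f T g u.
Proof.
move=> M0 [gM mu ur gu]; split.
- exact: lipschitz_AC gM.
- split=> [j|]; first exact: measurable_funS (mu j).
  have iu : leb.-integrable `[0, T] (EFin \o (fun s => dotv (u s) (u s))).
    apply: (@bounded_integrable _ _ _ _ (m%:R * (r * r))) => [|s _ _].
      rewrite (_ : (fun s => _) = (fun s => quad 1 0 (u s))).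
        apply: measurable_fun_continuous_coord => // [x|j].
          exact/differentiable_continuous/quad_differentiable.
        exact: measurable_funS (mu j).
      by apply/funext => s; rewrite /quad mul1r sub0r dotvN.
    rewrite (le_trans (ler_normr_dotv _ _))// ler_wpM2l//.
    by rewrite ler_pM.
  under eq_integral do rewrite enorm_sqr.
  exact: integrable_lty iu.
- have n0 := ae_neq 0; have nT := ae_neq T.
  move: gu n0 nT; apply: filterS3; first exact: (ae_filter_ringOfSetsType leb).
  move=> s H s0 sT; rewrite in_itv/= => /andP[s1 s2].
  by apply: H; rewrite in_itv/= !lt_neqAle s1 s2 eq_sym s0 sT.
Qed.

Lemma controlled_cost_integrable M r T g u : controlled M r T g u ->
  leb.-integrable `[0, T] (EFin \o (fun s => L (g s) (u s))).
Proof.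
move=> [gM mu ur _].
have [B B0 HB] := periodic_param_bounded (Lagrangian_continuous HL) (Lagrangian_periodic HL) r.
apply: (@bounded_integrable _ _ _ _ B) => [|s _ _]; last exact: HB.
apply: measurable_fun_continuous_coord2 => //.
- exact: Lagrangian_continuous HL.
- move=> j; apply: (@measurable_funS _ _ _ _ setT) => //.
  apply: continuous_measurable_fun => s.
  apply: (@continuous_comp _ _ _ g (fun z : 'rV[R]_d => z 0 j)).
    have cg : continuous g by exact: lipschitz_continuous gM.
    exact: cg.
  exact: coord_continuous.
- by move=> j; exact: measurable_funS (mu j).
Qed.

Lemma controlled_extend (M r T h B : R) (g1 : R -> 'rV[R]_d) (u1 : R -> 'rV[R]_m)
    (g2 : R -> 'rV[R]_d) (u2 : 'rV[R]_m) : 0 < M -> 0 <= T -> 0 < h ->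
  controlled M r T g1 u1 -> (forall a b, `|g2 b - g2 a| <= M * `|b - a|) ->
  `|u2| <= r -> (forall s, 0 < s -> s < h -> is_derive s 1 g2 (Fu f (g2 s) u2)) ->
  g1 T = g2 0 -> (forall s, 0 <= s -> s <= h -> L (g2 s) u2 <= B) ->
  exists g u, [/\ controlled M r (T + h) g u, g 0 = g1 0, g (T + h) = g2 h &
    \int[leb]_(s in `[0, T + h]) L (g s) (u s) <=
    \int[leb]_(s in `[0, T]) L (g1 s) (u1 s) + B * h].
Proof.
move=> M0 T0 h0 c1 g2M u2r d2 g12 LB.
have [g1M mu1 u1r d1] := c1.
(* The control may jump at the junction, where the glued curve need not be differentiable; this
   instant is discarded as a null set. *)
pose g s := if s <= T then g1 s else g2 (s - T).
pose u s := if s <= T then u1 s else u2.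
have cgu : controlled M r (T + h) g u.
  split.
  - move=> a b; wlog ab : a b / a <= b => [H|].
      have [ab|ba] := leP a b; first exact: H.
      by rewrite distrC (distrC b); apply: H; exact: ltW.
    rewrite /g; case: (leP a T) => aT; case: (leP b T) => bT //.
    + rewrite -(subrKA (g2 0)) (le_trans (ler_normD _ _))//.
      rewrite -[in X in _ + X]g12 (le_trans (lerD (g2M _ _) (g1M _ _)))//.
      rewrite subr0 -mulrDr ler_pM2l// !ger0_norm ?subr_ge0//; [lra|exact: ltW..].
    + by have := le_lt_trans ab (le_lt_trans bT aT); rewrite ltxx.
    + by rewrite (le_trans (g2M _ _))// opprB addrA subrK.
  - move=> j; rewrite (_ : (fun s => u s 0 j) =
        (fun s => if s <= T then u1 s 0 j else u2 0 j)); last first.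
      by apply/funext => s; rewrite /u; case: ifP.
    apply: measurable_fun_ifT => //; first exact: measurable_fun_ler.
  - by move=> s; rewrite /u; case: ifP.
  - have nT := ae_neq T.
    move: d1 nT; apply: filterS2; first exact: (ae_filter_ringOfSetsType leb).
    move=> s H sT; rewrite in_itv/= => /andP[s0 sTh].
    have [sT'|Ts] := ltP s T.
      rewrite {2}/g /u (ltW sT').
      have ds : is_derive s 1 g1 (Fu f (g1 s) (u1 s)) by apply: H; rewrite in_itv/= s0.
      move: ds; apply: near_eq_is_derive; near=> z.
      by rewrite /g ltW//; near: z; exact: lt_nbhsl.
    have Ts' : T < s by rewrite lt_neqAle eq_sym sT.
    rewrite {2}/g /u leNgt Ts'/=.
    have h1 : 0 < s - T by rewrite subr_gt0.
    have h2 : s - T < h by rewrite ltrBlDl.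
    have ds := d2 _ h1 h2.
    have hs : is_derive s 1 (fun s : R => s - T) 1.
      rewrite (_ : (fun s : R => s - T) = (fun s => - T + 1 * s)).
        exact: is_derive_affine.
      by apply/funext => z; rewrite mul1r addrC.
    have dfy : differentiable g2 (s - T) by apply/derivable1_diffP; case: ds.
    have := is_derive_comp_diff hs dfy; rewrite -deriveE//; case: ds => _ ->.
    apply: near_eq_is_derive; near=> z.
    by rewrite /g /= leNgt (_ : T < z)//; near: z; exact: lt_nbhsr.
exists g, u; split => //.
- by rewrite /g T0.
- by rewrite /g leNgt ltrDl h0/= addrC addKr.
have il := controlled_cost_integrable cgu.
have E : `[0, T + h]%classic = `[0, T] `|` `]T, T + h].
  apply/seteqP; split => s /=; rewrite !in_itv/=.
    by move=> /andP[s0 sTh]; case: (leP s T) => sT; [left; rewrite s0|right].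
  by move=> [/andP[s0 sT]|/andP[Ts sTh]]; apply/andP; split => //; lra.
have dj : [disjoint `[0, T] & `]T, T + h]%classic].
  apply/disj_setPS => s /= []; rewrite !in_itv/= => /andP[_ sT] /andP[].
  by rewrite ltNge sT.
rewrite E Rintegral_setU//; last by rewrite -E.
apply: lerD.
  rewrite le_eqVlt; apply/orP; left; apply/eqP/eq_Rintegral => s.
  by rewrite inE/= in_itv/= /g /u => /andP[_ ->].
have il2 : leb.-integrable `]T, T + h] (EFin \o (fun s => L (g s) (u s))).
  by apply: integrableS il => //; rewrite E; exact: subsetUr.
have iB : leb.-integrable `]T, T + h] (EFin \o cst B).
  apply: (@integrableS _ _ _ leb `[T, T + h]) => //; first exact: subset_itv_oc_cc.
  by apply: (@bounded_integrable _ _ _ _ `|B|).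
have -> : B * h = \int[leb]_(s in `]T, T + h]) B.
  rewrite Rintegral_itv_obnd_cbnd// Rintegral_cst_itv; last by rewrite lerDl ltW.
  by rewrite addrAC subrr add0r.
apply: le_Rintegral => // s /=; rewrite in_itv/= => /andP[Ts sTh].
rewrite /g /u (leNgt s T) Ts/=; apply: LB; first by rewrite subr_ge0 ltW.
by rewrite lerBlDl.
Unshelve. all: by end_near. Qed.

Variables (c : R) (v : 'rV[R]_d -> R).
Hypotheses (vcont : continuous v) (vper : Zperiodic v).

(* One step of proximal aiming: at [x] use the control that is almost optimal at the
   minimizer [Y x] of the inf-convolution [V]. *)
Lemma supersolution_step (eta : R) : 0 < eta -> visc_super c f L v ->
  exists (V : 'rV[R]_d -> R) (r M h0 : R), [/\ 0 < M, 0 < h0, 0 <= r,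
    forall x, v x - eta <= V x <= v x &
    forall h x, 0 < h -> h <= h0 -> exists (g : R -> 'rV[R]_d) (u : 'rV[R]_m) (B : R),
    [/\ g h = x /\ `|u| <= r, forall a b, `|g b - g a| <= M * `|b - a|,
      forall s, 0 < s -> s < h -> is_derive s 1 g (Fu f (g s) u),
      forall s, 0 <= s -> s <= h -> L (g s) u <= B &
      V (g 0) + B * h <= V x + (c + eta) * h]].
Proof.
move=> eta0 vsup.
have [K K0 HK] := Fu_lipschitz fsmooth fper.
have [r r0 Hr] := dual_selection HL c.
have [hf [M [C [hf0 M0 C0 Hflow]]]] := backward_flow r0.
(* Five errors occur: the choice of the control, moving [F] and moving [L] from [Y x] to [x], the
   second-order terms of the flow, and the variation of [L] along the step. The bound 1 is required
   by [dual_selection]. *)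
pose e1 := Num.min 1 (eta / 5).
have e10 : 0 < e1 by rewrite lt_min ltr01 divr_gt0.
have e1e : 5 * e1 <= eta by rewrite mulrC -ler_pdivlMr// ge_min lexx orbT.
have [dl dl0 Hdl] := periodic_param_uniform (Lagrangian_continuous HL)
  (Lagrangian_periodic HL) r e10.
have [dv dv0 Hdv] := periodic_uniform vcont vper eta0.
have dK0 : 0 < 2 * d%:R * K * r + 1 by rewrite ltr_wpDl// !mulr_ge0// ltW.
pose eta' := Num.min (Num.min dv dl) (e1 / (2 * d%:R * K * r + 1)).
have eta'0 : 0 < eta' by rewrite !lt_min dv0 dl0 divr_gt0.
(* The inf-convolution of [v] is minus the sup-convolution of [- v]. *)
have vNcont : continuous (fun x => - v x).
  by move=> x; apply: continuousN; exact: vcont.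
have vNper : Zperiodic (fun x => - v x) by move=> x i; rewrite vper.
have [k k0 /choice[Y HY]] := sup_convolution vNcont vNper eta'0.
have a1 : eta' <= dv by rewrite !ge_min lexx.
have a2 : eta' <= dl by rewrite !ge_min lexx orbT.
have a3 : (2 * d%:R * K * r + 1) * eta' <= e1.
  by rewrite mulrC -ler_pdivlMr// !ge_min lexx !orbT.
pose V x := v (Y x) + quad k x (Y x).
have quad0 (x y : 'rV[R]_d) : 0 <= quad k x y by rewrite mulr_ge0 ?dotv_ge0// ltW.
have quadxx (x : 'rV[R]_d) : quad k x x = 0 by rewrite /quad subrr dotv0l mulr0.
(* The coefficient of [h ^ 2] in the growth of the penalty: the flow error against its gradient,
   plus the squared displacement. With [h <= e1 / A] this costs at most [h * e1]. *)
pose A := 2 * k * d%:R * eta' * C + k * d%:R * M ^+ 2 + 1.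
have A0 : 0 < A.
  by rewrite ltr_wpDl// addr_ge0// !mulr_ge0// ?sqr_ge0// ltW.
pose h0 := Num.min hf (Num.min (dl / M) (e1 / A)).
exists V, r, M, h0; split => //.
- by rewrite !lt_min hf0 !divr_gt0.
- exact: ltW.
- move=> x; have [H1 H2 _] := HY x; apply/andP; split.
    have : `|x - Y x| <= dv by exact: le_trans a1.
    move=> /Hdv; rewrite ler_norml => /andP[_ +].
    by have := quad0 x (Y x); rewrite /V; lra.
  by have := H1 x; rewrite quadxx /V; lra.
move=> h x hpos; rewrite !le_min => /and3P[hhf hdl hA].
have [H1 H2 H3] := HY x.
pose p := (2 * k) *: (x - Y x).
have Hsup : 0 <= c + Ham f L (Y x) p.
  (* Since [Y x] minimizes [v + quad k x], the function [quad (- k) x] touches [v] from below there,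
     up to a constant. *)
  have -> : p = grad (quad (- k) x) (Y x).
    by rewrite grad_quad -(opprB x) scalerN -scaleNr -mulrN opprK.
  apply: vsup; first exact: C1_quad.
  near=> z; have := H1 z; rewrite /quad; lra.
have [u ur Hu] := Hr e1 (Y x) (p *m Fmat f (Y x)) e10
  (ltac:(by rewrite ge_min lexx)) ((Ham_geP f HL _ _ _).1 Hsup).
have [g [gh gM gD gE]] := Hflow h u x hpos hhf ur.
exists g, u, (L x u + e1); split => //.
  move=> s s0 sh; have : `|g s - x| <= dl.
    rewrite -gh (le_trans (gM _ _))// distrC ger0_norm ?subr_ge0//.
    rewrite mulrC -ler_pdivlMr// (le_trans _ hdl)//; lra.
  by move=> /(Hdl _ _ _ ur); rewrite ler_norml => /andP[_]; lra.
set w := g 0 - x.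
have wM : `|w| <= M * h.
  by rewrite /w -gh (le_trans (gM _ _))// sub0r normrN gtr0_norm.
(* The infimum defining [V (g 0)] is tested with the old minimizer [Y x], so only the penalty
   changes. *)
have VE : V (g 0) <= V x + 2 * k * dotv (x - Y x) w + k * dotv w w.
  have := H1 (Y x); have [H1' _ _] := HY (g 0); have := H1' (Y x).
  have -> : quad k (g 0) (Y x) = quad k x (Y x) + 2 * k * dotv (x - Y x) w + k * dotv w w.
    rewrite /quad (_ : g 0 - Y x = (x - Y x) + w); last by rewrite [RHS]addrC subrKA.
    by rewrite (dotvDD (x - Y x)); ring.
  rewrite /V; lra.
have pE : dotv p (Fu f (Y x) u) - dotv p (Fu f x u) <= e1.
  rewrite -dotvBr (le_trans (ler_dotv _ _))//.
  rewrite (@le_trans _ _ (d%:R * (`|p| * (K * (`|x - Y x| * r)))))//.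
    rewrite !ler_wpM2l// (le_trans (HK _ _ _))// distrC ler_wpM2l ?(ltW K0)//.
    by rewrite ler_wpM2l.
  rewrite /p normrZ ger0_norm; last by rewrite mulr_ge0// ltW.
  rewrite (le_trans _ a3)//.
  have H4 : k * (`|x - Y x| * `|x - Y x|) <= eta'.
    by apply: le_trans H3; rewrite ler_pM2l// -expr2 sqr_mxnorm_le_dotv.
  rewrite (_ : _ * eta' = 2 * d%:R * K * r * eta' + eta'); last by ring.
  rewrite ler_wpDr ?(ltW eta'0)//.
  rewrite (_ : d%:R * _ = 2 * d%:R * K * r * (k * (`|x - Y x| * `|x - Y x|))); last by ring.
  by rewrite ler_wpM2l// !mulr_ge0// ltW.
have LE : L (Y x) u >= L x u - e1.
  have : `|x - Y x| <= dl by exact: le_trans a2.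
  by move=> /(Hdl _ _ _ ur); rewrite ler_norml => /andP[_]; lra.
rewrite dotv_mulmx_Fmat in Hu.
have wE : 2 * k * dotv (x - Y x) w <= - h * dotv p (Fu f x u) +
    2 * k * (d%:R * (eta' * (C * h ^+ 2))).
  have -> : 2 * k * dotv (x - Y x) w =
      - h * dotv p (Fu f x u) + 2 * k * dotv (x - Y x) (w + h *: Fu f x u).
    by rewrite dotvDr dotvZr /p dotvZl; ring.
  rewrite lerD2l ler_wpM2l ?mulr_ge0 ?(ltW k0)// (le_trans (ler_dotv _ _))//.
  by rewrite ler_wpM2l// ler_pM.
have wwE : k * dotv w w <= k * (d%:R * (M ^+ 2 * h ^+ 2)).
  rewrite ler_wpM2l ?(ltW k0)// (le_trans (ler_dotv _ _))// ler_wpM2l//.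
  rewrite -exprMn [leRHS]expr2 ler_pM//.
have hAE : 2 * k * (d%:R * (eta' * (C * h ^+ 2))) + k * (d%:R * (M ^+ 2 * h ^+ 2)) <= h * e1.
  have -> : 2 * k * (d%:R * (eta' * (C * h ^+ 2))) + k * (d%:R * (M ^+ 2 * h ^+ 2)) =
    h * (h * (2 * k * d%:R * eta' * C + k * d%:R * M ^+ 2)) by ring.
  rewrite ler_pM2l// (@le_trans _ _ (h * A))//; first by rewrite ler_pM2l// lerDl.
  by rewrite -ler_pdivlMr.
have hp : h * (- c - e1 + (L x u - e1) - e1) <= h * dotv p (Fu f x u).
  by rewrite ler_pM2l//; lra.
have he : h * (5 * e1) <= h * eta by rewrite ler_pM2l.
lra.
Unshelve. all: by end_near. Qed.

(** Since the choice of control is made at final points, the last piece is chosen first, from [x];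
    the induction hypothesis supplies the curve that ends where this piece starts. *)
Lemma supersolution_iterate (V : 'rV[R]_d -> R) (r M h k : R) : 0 < M -> 0 < h -> 0 <= r ->
  (forall x, exists (g : R -> 'rV[R]_d) (u : 'rV[R]_m) (B : R),
    [/\ g h = x /\ `|u| <= r, forall a b, `|g b - g a| <= M * `|b - a|,
      forall s, 0 < s -> s < h -> is_derive s 1 g (Fu f (g s) u),
      forall s, 0 <= s -> s <= h -> L (g s) u <= B &
      V (g 0) + B * h <= V x + k * h]) ->
  forall n x, exists g u, [/\ controlled M r (n%:R * h) g u, g (n%:R * h) = x &
    V (g 0) + \int[leb]_(s in `[0, n%:R * h]) L (g s) (u s) <= V x + k * (n%:R * h)].
Proof.
move=> M0 h0 r0 step; elim=> [|n IH] x.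
  exists (cst x), (cst 0); rewrite mul0r; split => //.
    split=> [a b|j|s|].
    - by rewrite subrr normr0 mulr_ge0// ltW.
    - exact: measurable_cst.
    - by rewrite normr0.
    - apply: aeW => s; rewrite in_itv/= => /andP[s0 /(lt_trans s0)].
      by rewrite ltxx.
  by rewrite set_itv1 Rintegral_set1 mulr0.
have [g2 [u2 [B [[g2h u2r] g2M d2 LB HB]]]] := step x.
have [g1 [u1 [c1 g1T H1]]] := IH (g2 0).
have nh0 : 0 <= n%:R * h by rewrite mulr_ge0// ltW.
have [g [u [cgu g0 gT HI]]] :=
  controlled_extend M0 nh0 h0 c1 g2M u2r d2 g1T LB.
have E : n.+1%:R * h = n%:R * h + h by rewrite -natr1 mulrDl mul1r.
exists g, u; rewrite E; split => //; first by rewrite gT.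
rewrite g0 mulrDr; lra.
Qed.

Lemma supersolution_ge_cost t x e : 0 <= t -> 0 < e -> visc_super c f L v ->
  exists g u, [/\ admissible f t g u, g t = x &
    ((v (g 0))%:E + cost L t g u <= (v x + c * t + e)%:E)%E].
Proof.
move=> t0 e0 vsup; have t10 : 0 < t + 1 by rewrite ltr_wpDl.
have [V [r [M [h0 [M0 h00 r0 vV step]]]]] :=
  supersolution_step (divr_gt0 e0 t10) vsup.
set eta := e / (t + 1) in vV step.
(* The time is cut into equal steps of admissible length; for [t = 0] there is no step and any
   positive length will do. *)
have [n [h [hpos hh0 tE]]] : exists n h, [/\ 0 < h, h <= h0 & t = n%:R * h].
  have [->|tn0] := eqVneq t 0; first by exists 0%N, h0; rewrite mul0r.
  have tpos : 0 < t by rewrite lt_neqAle eq_sym tn0.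
  have hx : 0 <= t / h0 by rewrite divr_ge0// ltW.
  pose n := (Num.truncn (t / h0)).+1; have n0 : 0 < n%:R :> R by rewrite ltr0n.
  exists n, (t / n%:R); split; first exact: divr_gt0.
    rewrite ler_pdivrMr// mulrC -ler_pdivrMr// ltW//.
    by have /andP[] := truncn_itv hx.
  by rewrite mulrC divfK// gt_eqF.
have [g [u [cgu gt HI]]] :=
  supersolution_iterate M0 hpos r0 (fun x => step h x hpos hh0) n x.
rewrite -tE in cgu gt HI.
exists g, u; split => //; first exact: controlled_admissible cgu.
rewrite costE; last exact: controlled_cost_integrable cgu.
rewrite -EFinD lee_fin.
have /andP[v1 _] := vV (g 0); have /andP[_ v2] := vV x.
have eE : eta * (t + 1) = e by rewrite /eta divfK// gt_eqF.
lra.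
Qed.

End Supersolution.

(** * Fixed points of the Lax-Oleinik semigroup *)

Section TestFunctions.
Context {R : realType} {d m : nat}.
Variables (f : 'I_m -> 'rV[R]_d -> 'rV[R]_d).
Hypotheses (fsmooth : forall i, smooth (f i)) (fper : forall i, Zperiodic (f i)).

Lemma grad_near (phi : 'rV[R]_d -> R) x0 (e : R) : C1 phi -> 0 < e ->
  exists2 rho, 0 < rho &
    forall x, `|x - x0| <= rho -> `|grad phi x - grad phi x0| <= e.
Proof.
move=> [_ cphi] e0.
have Hi i : \forall x \near x0, `|'D_(ebasis i) phi x0 - 'D_(ebasis i) phi x| <= e.
  by have /cvgrPdist_le := cphi i x0; apply.
have : nbhs x0 (fun x => forall i, `|'D_(ebasis i) phi x0 - 'D_(ebasis i) phi x| <= e).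
  exact: (@filter_forall _ _ _ (nbhs x0) (nbhs_filter x0) Hi).
rewrite -nbhs_ballE => -[rho /= rho0 H].
exists (rho / 2); first by rewrite divr_gt0.
move=> x xx0; apply: mxnorm_leP => [|i]; first exact: ltW.
rewrite !mxE distrC; apply: H; rewrite -ball_normE/= distrC.
by rewrite (le_lt_trans xx0)//; lra.
Qed.

Lemma C1_lipschitz_near (phi : 'rV[R]_d -> R) x0 (rho e : R) : C1 phi ->
  (forall x, `|x - x0| <= rho -> `|grad phi x - grad phi x0| <= e) ->
  forall x y, `|x - x0| <= rho -> `|y - x0| <= rho ->
    `|phi x - phi y| <= d%:R * (`|grad phi x0| + e) * `|x - y|.
Proof.
move=> [dphi _] H x y xr yr.
pose g (s : R) : 'rV[R]_d := y + s *: (x - y).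
have dg (s : R) : is_derive s 1 g (x - y) by exact: is_derive_line.
have dpg (s : R) : is_derive s 1 (phi \o g) ('d phi (g s) (x - y)).
  exact: is_derive_comp_diff.
have [|s] := @MVT R _ _ 0 1 ltr01 (fun s _ => dpg s).
  apply: continuous_subspaceT => s; apply: differentiable_continuous.
  by apply/derivable1_diffP; case: (dpg s).
rewrite in_itv/= => /andP[s0 s1].
rewrite /= /g scale0r scale1r addr0 subrKC subr0 mulr1 => ->.
rewrite -/(g s) diff_dotv_grad// (le_trans (ler_normr_dotv _ _))// -mulrA.
rewrite ler_wpM2l// ler_wpM2r//.
have gr : `|g s - x0| <= rho.
  rewrite (_ : g s - x0 = (1 - s) *: (y - x0) + s *: (x - x0)); last first.
    by apply/rowP => i; rewrite !mxE; ring.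
  rewrite (le_trans (ler_normD _ _))// !normrZ !ger0_norm ?(ltW s0)//; last by lra.
  have : (1 - s) * `|y - x0| <= (1 - s) * rho by rewrite ler_wpM2l//; lra.
  have : s * `|x - x0| <= s * rho by rewrite ler_wpM2l// ltW.
  lra.
rewrite -lerBlDl (le_trans (lerB_dist _ _))//; exact: H.
Qed.

(** These are the two properties required of a test function along a curve near [x0]: the Lipschitz
    bound makes [phi] absolutely continuous along it, and the almost constant horizontal gradient
    bounds the derivative. *)
Lemma C1_near (phi : 'rV[R]_d -> R) x0 (e : R) : C1 phi -> 0 < e ->
  exists rho C : R, [/\ 0 < rho, 0 < C,
    forall x y, `|x - x0| <= rho -> `|y - x0| <= rho ->
      `|phi x - phi y| <= C * `|x - y| &
    forall x, `|x - x0| <= rho ->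
      `|grad phi x0 *m Fmat f x0 - grad phi x *m Fmat f x| <= e].
Proof.
move=> cphi e0.
have [K K0 HK] := Fu_lipschitz fsmooth fper.
have [M M0 HM] := Fu_bounded fsmooth fper.
have e2 : 0 < e / 2 by rewrite divr_gt0.
have a1 : 0 < d%:R * M + 1 by rewrite ltr_wpDl// mulr_ge0// ltW.
have a2 : 0 < d%:R * (K * `|grad phi x0|) + 1.
  by rewrite ltr_wpDl// !mulr_ge0// ltW.
pose e1 := e / 2 / (d%:R * M + 1); have e10 : 0 < e1 by rewrite divr_gt0.
have [rho rho0 Hrho] := grad_near x0 cphi e10.
exists (Num.min rho (e / 2 / (d%:R * (K * `|grad phi x0|) + 1))),
  (d%:R * (`|grad phi x0| + e1) + 1); split.
- by rewrite lt_min rho0 divr_gt0.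
- by rewrite ltr_wpDl// mulr_ge0// addr_ge0// ltW.
- move=> x y; rewrite !le_min => /andP[xr _] /andP[yr _].
  rewrite (le_trans (C1_lipschitz_near cphi Hrho xr yr))//.
  by rewrite ler_wpM2r// lerDl.
move=> x; rewrite le_min => /andP[xr xK].
have -> : grad phi x0 *m Fmat f x0 - grad phi x *m Fmat f x =
    (grad phi x0 *m Fmat f x0 - grad phi x0 *m Fmat f x) -
    (grad phi x - grad phi x0) *m Fmat f x.
  by rewrite mulmxBl opprB addrA subrK.
rewrite (le_trans (ler_normB _ _))// [e]splitr lerD//.
  rewrite (le_trans (mulmx_Fmat_shift _ _ _ HK (ltW K0)))//.
  rewrite (_ : d%:R * _ = `|x - x0| * (d%:R * (K * `|grad phi x0|))); last by ring.
  rewrite ler_pdivlMr// in xK; apply: le_trans xK.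
  by rewrite ler_wpM2l// lerDl.
apply: mxnorm_leP => [|j]; first exact: ltW.
have -> : ((grad phi x - grad phi x0) *m Fmat f x) 0 j =
    dotv (grad phi x - grad phi x0) (Fu f x (ebasis j)).
  by rewrite -dotv_mulmx_Fmat -[ebasis j]scale1r dotv_unit mul1r.
rewrite (le_trans (ler_normr_dotv _ _))//.
have Mj : `|Fu f x (ebasis j)| <= M.
  rewrite (le_trans (HM _ _))// ler_piMr ?(ltW M0)//.
  by rewrite -[ebasis j]scale1r normr_ebasis// normr1.
rewrite (@le_trans _ _ (d%:R * (e1 * M)))//.
  by rewrite ler_wpM2l// ler_pM// Hrho.
rewrite (_ : d%:R * _ = e1 * (d%:R * M)); last by ring.
rewrite (@le_trans _ _ (e1 * (d%:R * M + 1)))//; last by rewrite /e1 divfK// gt_eqF.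
by rewrite ler_wpM2l ?(ltW e10)// lerDl.
Qed.

End TestFunctions.

Section FixedPoint.
Context {R : realType} {d m : nat}.
Local Notation leb := (@lebesgue_measure R).
Variables (f : 'I_m -> 'rV[R]_d -> 'rV[R]_d) (L : 'rV[R]_d -> 'rV[R]_m -> R).
Hypotheses (fsmooth : forall i, smooth (f i)) (fper : forall i, Zperiodic (f i)).
Hypothesis HL : condL L.
Variables (c : R) (v : 'rV[R]_d -> R).
Hypotheses (vcont : continuous v) (vper : Zperiodic v).
Hypothesis vfix : forall (t : R) x, 0 <= t ->
  (v x)%:E = (LaxOleinik f L t v x - (c * t)%:E)%E.

(** The identity also shows that the infimum is finite, which allows moving [c * t] across it. *)
Let LaxE t x : 0 <= t -> LaxOleinik f L t v x = (v x + c * t)%:E.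
Proof. by move=> t0; rewrite EFinD (vfix x t0) subeK. Qed.

Lemma fixpoint_le_cost t g u : 0 <= t -> admissible f t g u ->
  ((v (g t) + c * t)%:E <= (v (g 0))%:E + cost L t g u)%E.
Proof.
move=> t0 agu; rewrite -LaxE//; apply: ereal_inf_lbound.
by exists g, u.
Qed.

Lemma fixpoint_near_optimal t x e : 0 <= t -> 0 < e -> exists g u,
  [/\ admissible f t g u, g t = x &
    ((v (g 0))%:E + cost L t g u < (v x + c * t + e)%:E)%E].
Proof.
move=> t0 e0; have : (LaxOleinik f L t v x < (v x + c * t + e)%:E)%E.
  by rewrite LaxE// lte_fin ltrDl.
move=> /ereal_inf_lt[_ [g [u [agu gt ->]]] H]; by exists g, u.
Qed.

Lemma fixpoint_subsolution : visc_sub c f L v.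
Proof.
move=> phi x0 cphi touch; apply/(Ham_leP f HL) => u.
rewrite leNgt; apply/negP => Hu.
set q0 := grad phi x0 *m Fmat f x0 in Hu.
(* One third is spent on the variation of [L] along the arc and one on that of the derivative of
   [phi]; the last third is the contradiction. *)
pose dt := (dotv q0 u - (L x0 u - c)) / 3.
have dt0 : 0 < dt by rewrite divr_gt0// subr_gt0.
have dtE : dotv q0 u = L x0 u - c + 3 * dt by rewrite /dt; field.
pose r := `|u| + 1; have r0 : 0 < r by rewrite ltr_wpDl.
have ur : `|u| <= r by rewrite lerDl.
have [hf [M [K [hf0 M0 K0 Hflow]]]] := backward_flow fsmooth fper r0.
have mu0 : 0 < m%:R * `|u| + 1 by rewrite ltr_wpDl// mulr_ge0.
have e0 : 0 < dt / (m%:R * `|u| + 1) by rewrite divr_gt0.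
have [rho [C [rho0 C0 phiC Hq]]] := C1_near fsmooth fper x0 cphi e0.
have [dl dl0 Hdl] := periodic_param_uniform (Lagrangian_continuous HL)
  (Lagrangian_periodic HL) r dt0.
have : nbhs x0 (fun y => v y - phi y <= v x0 - phi x0) := touch.
rewrite -nbhs_ballE => -[rho2 /= rho20 Htouch].
(* The arc must exist, and its length [M * h] must respect the neighbourhoods for [phi], for [L] and
   for the touching condition; the half is there because the touching ball is open. *)
pose h := Num.min (Num.min hf (rho / M)) (Num.min (dl / M) (rho2 / 2 / M)).
have h0 : 0 < h by rewrite !lt_min hf0 !divr_gt0.
have hhf : h <= hf by rewrite !ge_min lexx.
have hrho : h * M <= rho by rewrite -ler_pdivlMr// !ge_min lexx !orbT.
have hdl : h * M <= dl by rewrite -ler_pdivlMr// !ge_min lexx !orbT.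
have hrho2 : h * M <= rho2 / 2 by rewrite -ler_pdivlMr// !ge_min lexx !orbT.
have [g [gh gM gD _]] := Hflow h u x0 h0 hhf ur.
have gx0 s : 0 <= s -> s <= h -> `|g s - x0| <= h * M.
  move=> s0 sh; rewrite -gh (le_trans (gM _ _))// distrC ger0_norm ?subr_ge0//.
  by rewrite mulrC ler_pM2r// gerBl.
have cg : controlled f M r h g (cst u).
  by split => //; apply: aeW => s; rewrite in_itv/= => /andP[]; exact: gD.
have ag := controlled_admissible M0 cg.
have := fixpoint_le_cost (ltW h0) ag.
have il := controlled_cost_integrable HL cg.
rewrite costE// -EFinD lee_fin gh => H1.
have H2 : \int[leb]_(s in `[0, h]) L (g s) u <= (L x0 u + dt) * h.
  rewrite (_ : (L x0 u + dt) * h = \int[leb]_(s in `[0, h]) (L x0 u + dt)); last first.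
    by rewrite Rintegral_cst_itv ?(ltW h0)// subr0.
  apply: le_Rintegral => //.
    by apply: (@bounded_integrable _ _ _ _ `|L x0 u + dt|).
  move=> s /=; rewrite in_itv/= => /andP[s0 sh].
  have : `|g s - x0| <= dl by rewrite (le_trans (gx0 s s0 sh)).
  by move=> /(Hdl _ _ _ ur); rewrite ler_norml => /andP[_]; lra.
have H3 : v (g 0) - phi (g 0) <= v x0 - phi x0.
  apply: Htouch; rewrite -ball_normE/= distrC (le_lt_trans (gx0 0 _ (ltW h0)))//.
  by rewrite (le_lt_trans hrho2)//; lra.
(* The integral inequality is one-sided; applied to [- phi] it bounds the increment of [phi] from
   below. *)
have H4 : - phi (g h) - - phi (g 0) <=
    \int[leb]_(s in `[0, h]) (- dotv q0 u + dt).
  apply: (@ACr_le_integral _ (fun s => - phi (g s)) (cst (- dotv q0 u + dt)) h 0 h) => //.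
  - case: ag => ag _ _.
    apply: (@AC_comp_lipschitz _ _ g h [set x | `|x - x0| <= rho] (fun x => - phi x) C) => //.
      by move=> s s0 sh; exact: le_trans (gx0 s s0 sh) hrho.
    by move=> x y xr yr _; rewrite opprK addrC distrC phiC.
  - by apply: (@bounded_integrable _ _ _ _ `|- dotv q0 u + dt|).
  - apply: aeW => s; rewrite in_itv/= => /andP[s0 sh].
    have dpg : is_derive s 1 (phi \o g) ('d phi (g s) (Fu f (g s) u)).
      by apply: is_derive_comp_diff; [exact: gD|case: cphi].
    have /is_derive_left_dini_le : is_derive s 1 (- (phi \o g)) (- 'd phi (g s) (Fu f (g s) u)).
      exact: is_deriveN.
    apply: left_dini_le_mono => //.
    rewrite diff_dotv_grad; last by case: cphi.
    rewrite -dotv_mulmx_Fmat lerNl opprD opprK -lerBrDr opprK -lerBlDl -dotvBl.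
    have gsr : `|g s - x0| <= rho by exact: le_trans (gx0 s (ltW s0) (ltW sh)) hrho.
    rewrite (le_trans (dotv_le_bound u (Hq _ gsr)))//.
    rewrite mulrAC [leLHS]mulrC -[leRHS](divfK (lt0r_neq0 mu0)).
    by rewrite ler_wpM2l ?(ltW e0)// lerDl.
  exact: ltW.
rewrite Rintegral_cst_itv ?(ltW h0)// subr0 gh in H4.
have : 0 < dt * h by rewrite mulr_gt0.
have : dotv q0 u * h = (L x0 u - c + 3 * dt) * h by rewrite dtE.
lra.
Qed.

(* Coercivity bounds the length [\int |u|] of a near-optimal curve by [rho / 2] for
   small times, so the curve stays where the strict inequality at [x0] persists. *)
Lemma fixpoint_supersolution : visc_super c f L v.
Proof.
move=> phi x0 cphi touch; rewrite leNgt; apply/negP => Hneg.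
set q0 := grad phi x0 *m Fmat f x0.
pose dt := - (c + Ham f L x0 (grad phi x0)).
have dt0 : 0 < dt by rewrite oppr_gt0.
have Hq0 : forall u, dotv q0 u <= L x0 u - (c + dt).
  by apply/(Ham_leP f HL); rewrite /dt; lra.
have dt2 : 0 < dt / 2 by rewrite divr_gt0.
have [dl dl0 Hdl] := dual_constraint_shift HL (c + dt) dt2.
have [rho1 [C1 [rho10 C10 phiC Hq]]] := C1_near fsmooth fper x0 cphi dl0.
have : nbhs x0 (fun y => v x0 - phi x0 <= v y - phi y) := touch.
rewrite -nbhs_ballE => -[rho2 /= rho20 Htouch].
pose rho := Num.min (Num.min rho1 dl) (Num.min rho2 1).
have rho0 : 0 < rho by rewrite !lt_min rho10 dl0 rho20/=.
have rlel : rho <= 1 by rewrite !ge_min lexx !orbT.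
have rle1 : rho <= rho1 by rewrite !ge_min lexx.
have rledl : rho <= dl by rewrite !ge_min lexx orbT.
have rle2 : rho <= rho2 by rewrite !ge_min lexx orbT.
have [B B0 HB] := periodic_bounded vcont vper.
have [M M0 HM] := Fu_bounded fsmooth fper.
(* [2 * B + 1] will bound [k] times the integral of [M * |u|]: [2 * B] is the oscillation of [v],
   and 1 covers all terms proportional to time. As [rho <= 1], [k >= 1], whence [M <= C] in the
   domination by [L + D]. *)
pose k := (2 * B + 1) / (rho / 2).
have k1 : 1 <= k by rewrite ler_pdivlMr ?divr_gt0//; lra.
pose C := k * M; have C0 : 0 < C by rewrite mulr_gt0// (lt_le_trans _ k1).
have [D D0 HD] := Lagrangian_coercive HL (ltW C0).
have kt0 : 0 < `|c| + dt + D by rewrite ltr_wpDr// ltr_wpDl.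
(* Chosen so that [|c| * t], [D * t] and the slack of near-optimality add up to at most 1. *)
pose t := (`|c| + dt + D)^-1; have t0 : 0 < t by rewrite invr_gt0.
have tE : `|c| * t + dt * t + D * t = 1.
  by rewrite -!mulrDl /t divff// gt_eqF.
have dtt : 0 < dt * t by rewrite mulr_gt0.
(* Half of the margin [dt] survives along the curve and yields a gain of [dt * t / 2]; a quarter for
   near-optimality leaves a contradiction. *)
have e0 : 0 < dt * t / 4 by rewrite divr_gt0.
have [g [u [[ag au ae] gt Hopt]]] := fixpoint_near_optimal x0 (ltW t0) e0.
have coo : (cost L t g u < +oo)%E.
  rewrite ltNge leye_eq; apply/negP => /eqP E.
  by move: Hopt; rewrite E addey.
have il := running_cost_integrable HL ag au coo.
rewrite costE// -EFinD lte_fin in Hopt.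
set I := Rintegral _ _ _ in Hopt.
have ae' : {ae leb, forall s, s \in `]0, t[ -> is_derive s 1 g (Fu f (g s) (u s))}.
  move: ae; apply: filterS; first exact: (ae_filter_ringOfSetsType leb).
  move=> s Hs; rewrite in_itv/= => /andP[s0 st].
  by apply: Hs; rewrite in_itv/= !ltW.
have munorm : measurable_fun `[0, t] (fun s => `|u s|).
  apply: (@measurable_fun_continuous_coord _ _ (fun z : 'rV[R]_m => `|z|)) => //.
    exact: norm_continuous.
  by case: au.
have iu : leb.-integrable `[0, t] (EFin \o (fun s => M * `|u s|)).
  apply: (@le_integrable _ _ _ leb _ (measurable_itv _) _
      (EFin \o (fun s => L (g s) (u s) + D))) => //.
  - apply/measurable_EFinP; exact: measurable_funM.
  - move=> s _ /=; rewrite lee_fin ger0_norm; last by rewrite mulr_ge0// ltW.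
    rewrite (le_trans _ (ler_norm _))//.
    have : M * `|u s| <= C * `|u s|.
      by rewrite ler_wpM2r// /C ler_peMl// ltW.
    by have := HD (g s) (u s); lra.
  - exact: integrable_addr_cst.
have length_le : \int[leb]_(s in `[0, t]) (M * `|u s|) <= rho / 2.
  have kk : 0 < k by exact: lt_le_trans k1.
  rewrite -(ler_pM2l kk) -RintegralZl//.
  have -> : k * (rho / 2) = 2 * B + 1.
    by rewrite /k divfK// gt_eqF// divr_gt0.
  apply: (@le_trans _ _ (\int[leb]_(s in `[0, t]) (L (g s) (u s) + D))).
    apply: le_Rintegral => //.
    - have : leb.-integrable `[0, t] (fun s => k%:E * (M * `|u s|)%:E)%E.
        exact: integrableZl.
      by apply: eq_integrable.
    - exact: integrable_addr_cst.
    - by move=> s _; have := HD (g s) (u s); rewrite /C mulrA; lra.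
  rewrite Rintegral_addr_cst ?(ltW t0)// -/I.
  have := HB x0; have := HB (g 0); rewrite !ler_norml => /andP[? ?] /andP[? ?].
  have : c * t <= `|c| * t by rewrite ler_wpM2r ?(ltW t0)// ler_norm.
  lra.
have grho s : 0 <= s -> s <= t -> `|g s - x0| <= rho / 2.
  move=> s0 st.
  have sub : `[s, t] `<=` `[0, t] by apply: subset_itvr; rewrite bnd_simp.
  have Hint : \int[leb]_(z in `[s, t]) (M * `|u z|) <= rho / 2.
    apply: le_trans length_le; rewrite /Rintegral fine_le//.
    - by apply: integrable_fin_num => //; exact: integrableS iu.
    - exact: integrable_fin_num.
    apply: ge0_subset_integral => //; first by case/integrableP: iu.
    by move=> z _; rewrite lee_fin mulr_ge0// ltW.
  rewrite -gt distrC; apply: mxnorm_leP => [|i]; first by rewrite divr_ge0// ltW.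
  (* The signs 1 and -1 turn the one-sided integral inequality into a bound on the absolute value of
     each coordinate. *)
  have gi (sg : R) : `|sg| <= 1 -> sg * g t 0 i - sg * g s 0 i <= rho / 2.
    move=> sg1; apply: le_trans Hint.
    apply: (@ACr_le_integral _ (fun z => sg * g z 0 i) (fun z => M * `|u z|) t s t) => //.
      apply: (@AC_comp_lipschitz _ _ g t setT (fun x => sg * x 0 i) 1) => // x y _ _ _.
      rewrite -mulrBr normrM ler_pM//.
      by rewrite (le_trans _ (mxnorm_coord (x - y) i))// !mxE.
    move: ae'; apply: filterS; first exact: (ae_filter_ringOfSetsType leb).
    move=> z Hz zt; have /(is_derive_coord i) dz := Hz zt.
    have /is_derive_left_dini_le : is_derive z 1 (sg \*: (fun r => g r 0 i))
        (sg *: Fu f (g z) (u z) 0 i) by exact: is_deriveZ.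
    apply: left_dini_le_mono => //.
    rewrite (le_trans (ler_norm _))// normrZ (le_trans _ (HM (g z) (u z)))//.
    by rewrite (le_trans _ (mxnorm_coord _ i))// ler_piMl.
  rewrite !mxE ler_norml.
  have := gi 1; rewrite normr1 => /(_ (lexx _)).
  have := gi (-1); rewrite normrN normr1 => /(_ (lexx _)); lra.
have grho' s : 0 <= s -> s <= t -> `|g s - x0| <= rho.
  by move=> s0 st; rewrite (le_trans (grho s s0 st))//; lra.
have H1 : phi (g t) - phi (g 0) <=
    \int[leb]_(s in `[0, t]) (L (g s) (u s) + (- c - dt / 2)).
  apply: (@ACr_le_integral _ (phi \o g) (fun s => L (g s) (u s) + (- c - dt / 2)) t 0 t) => //.
  - apply: (@AC_comp_lipschitz _ _ g t [set x | `|x - x0| <= rho1] phi C1) => //.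
      by move=> s s0 st; exact: le_trans (grho' s s0 st) rle1.
    by move=> x y xr yr _; exact: phiC.
  - exact: integrable_addr_cst.
  - move: ae'; apply: filterS; first exact: (ae_filter_ringOfSetsType leb).
    move=> s Hs st.
    have dpg : is_derive s 1 (phi \o g) ('d phi (g s) (Fu f (g s) (u s))).
      by apply: is_derive_comp_diff; [exact: Hs|case: cphi].
    have /is_derive_left_dini_le := dpg; apply: left_dini_le_mono => //.
    rewrite diff_dotv_grad; last by case: cphi.
    rewrite -dotv_mulmx_Fmat.
    move: st; rewrite in_itv/= => /andP[/ltW s0 /ltW st].
    have h1 : `|g s - x0| <= dl := le_trans (grho' s s0 st) rledl.
    have h2 := Hq (g s) (le_trans (grho' s s0 st) rle1).
    by have := Hdl (g s) x0 q0 _ h1 h2 Hq0 (u s); lra.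
  exact: ltW.
rewrite Rintegral_addr_cst ?(ltW t0)// -/I gt in H1.
have H2 : v x0 - phi x0 <= v (g 0) - phi (g 0).
  apply: Htouch; rewrite -ball_normE/= distrC.
  by rewrite (le_lt_trans (grho 0 _ (ltW t0)))//; lra.
lra.
Qed.

End FixedPoint.

Unset Implicit Arguments.

Theorem theorem5p3 (R : realType) (d m : nat)
  (f : 'I_m -> 'rV[R]_d -> 'rV[R]_d) (L : 'rV[R]_d -> 'rV[R]_m -> R)
  (cbar : R) (v : 'rV[R]_d -> R) :
  (0 < m)%N -> (m <= d)%N ->
  (forall i, smooth (f i)) -> (forall i, Zperiodic (f i)) -> hormander f ->
  condF f -> condL L -> condS f L ->
  (forall x, (fine (VT f L T x) / T) @[T --> +oo] --> cbar) ->
  Zperiodic v -> continuous v ->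
  (visc_sol cbar f L v <->
   forall (t : R) (x : 'rV[R]_d), 0 <= t ->
     (v x)%:E = (LaxOleinik f L t v x - (cbar * t)%:E)%E).
Proof.
move=> _ _ fsmooth fper _ _ HL _ _ vper vcont; split=> [[_ vsub vsup] t x t0|vfix].
  suff -> : LaxOleinik f L t v x = (v x + cbar * t)%:E by rewrite -EFinB addrK.
  apply/eqP; rewrite eq_le; apply/andP; split.
    apply/lee_addgt0Pr => e e0.
    have [g [u [agu gt H]]] :=
      supersolution_ge_cost fsmooth fper HL vcont vper x t0 e0 vsup.
    rewrite -EFinD; apply: le_trans H; apply: ereal_inf_lbound.
    by exists g, u.
  apply: le_ereal_inf_tmp => _ [g [u [agu <- ->]]].
  exact: (subsolution_le_cost fsmooth fper HL vcont vper t0 vsub agu).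
split => //.
- exact: (fixpoint_subsolution fsmooth fper HL vfix).
- exact: (fixpoint_supersolution fsmooth fper HL vcont vper vfix).
Qed.
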